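(* There is an algorithm which, given a partition $0=t_0<t_1<\dots<t_n=1$ of $[0,1]$ and the $n$ values of a function $f\in X$ on the intervals $(t_{i-1},t_i)$, where $X$ is the set of all functions in $\mathcal L$ that are constant on each $(t_{i-1},t_i)$, $i=1,\dots,n$, computes all Kolmogorov signatures $s_k(f)$, $k\in\mathbb N_0$ (i.e. outputs the finite sequence of all strictly positive $s_k(f)$, all remaining signatures being zero), in time $O(n\log n)$.
   Context: $\mathcal L$ is the set of Lebesgue-measurable essentially bounded functions $f:[0,1]\to\mathbb R$ with $f(t)=\lim_{\epsilon\to0}\inf_{0<\delta<\epsilon}\frac{1}{t^+(\delta)-t^-(\delta)}\int_{t^-(\delta)}^{t^+(\delta)}f(s)\,ds$ for all $t\in[0,1]$, where $t^-(\delta)=\max(0,t-\delta)$, $t^+(\delta)=\min(1,t+\delta)$. Thus $f\in X$ is determined by its values on the open intervals: at an interior partition point its value is the average of the two adjacent values, and at $0$ and $1$ it is the adjacent value. Number of modes: for $g:[0,1]\to\mathbb R$ and a partition $P$: $0=u_0<\dots<u_{N}=1$, let $M(g,P)$ be the number of indices $0<i<N$ with $\max(g(u_{i-1}),g(u_{i+1}))<g(u_i)$, and let $M(g)=\sup_PM(g,P)$ over all finite partitions. Kolmogorov distance: $d_K(f,g)=\sup_{x\in[0,1]}\left|\int_0^x(f(s)-g(s))\,ds\right|$. Kolmogorov signatures: $s_k(f)=\inf\{d_K(f,g): g\in X,\ M(g)\le k\}$, $k\in\mathbb N_0$. Running time counts exact real arithmetic operations and comparisons (real RAM model). *)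

(* Defs.v *)
From HB Require Import structures.
From mathcomp Require Import all_boot all_order all_algebra.
From mathcomp Require Import all_classical all_reals all_analysis.

Set Implicit Arguments.
Unset Strict Implicit.
Unset Printing Implicit Defensive.

Import Order.TTheory GRing.Theory Num.Theory.
Import numFieldNormedType.Exports.

Local Open Scope classical_set_scope.
Local Open Scope ring_scope.

(** * Step functions on [0, 1] and Kolmogorov signatures

    A function [0, 1] -> R is represented by a function [R -> R] of which only
    the values on [0, 1] are ever used. *)

Section Signatures.
Context {R : realType}.
Implicit Types (f g : R -> R) (t u : seq R).

(** Lebesgue (as opposed to Borel) measurable sets: the domain carries the
    completed sigma-algebra, on which [completed_lebesgue_measure] lives. *)
Definition lebesgue_measurable_fun (D : set R) f : Prop :=
  measurable_fun (T := caratheodory_type (@wlength R idfun)^*%mu) D f.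

Definition essentially_bounded_on (D : set R) f : Prop :=
  exists M : R, \forall s \ae completed_lebesgue_measure, D s -> `|f s| <= M.

Definition local_average f (x d : R) : R :=
  let a := Num.max 0 (x - d) in
  let b := Num.min 1 (x + d) in
  (b - a)^-1 * \int[completed_lebesgue_measure]_(s in `[a, b]) f s.

(** The class written as a calligraphic L. *)
Definition calL f : Prop :=
  [/\ lebesgue_measurable_fun `[0, 1] f,
      essentially_bounded_on `[0, 1] f
    & forall x, x \in `[0, 1] ->
        inf [set local_average f x d | d in `]0, e[] @[e --> 0^'+] --> f x].

(** [u = [:: u_0; ...; u_N]] with [0 = u_0 < ... < u_N = 1]. *)
Definition unit_partition u : bool :=
  [&& sorted <%R u, head 1 u == 0 & last 0 u == 1].

(** The set X attached to the partition [t]. *)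
Definition stepX t f : Prop :=
  calL f /\
  forall i, (i.+1 < size t)%N ->
    exists c : R, forall x, x \in `]t`_i, t`_i.+1[ -> f x = c.

Definition modes_on g u : nat :=
  (\sum_(1 <= i < (size u).-1)
      (Num.max (g u`_i.-1) (g u`_i.+1) < g u`_i)%R)%N.

Definition modes g : \bar R :=
  ereal_sup [set ((modes_on g u)%:R)%:E | u in [set u | unit_partition u]].

Definition dK f g : R :=
  sup [set `|\int[completed_lebesgue_measure]_(s in `[0, x]) (f s - g s)|
      | x in `[0, 1]].

Definition signature t f (k : nat) : R :=
  inf [set dK f g | g in [set g | stepX t g /\ (modes g <= k%:R%:E)%E]].

End Signatures.

(** * The real RAM

    Memory consists of integer arrays and real arrays; a program, being a finite
    piece of syntax, can name only finitely many of them. A scalar register is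
    a cell of an array at a constant index. Integers serve for indirect
    addressing and control: there are no conversions between integers and reals
    and no rounding. Control is structured, which a machine with
    jumps simulates with constant overhead. *)

Inductive iexp : Type :=
  | IConst of nat
  | IGet of nat & iexp            (* integer array, index *)
  | IAdd of iexp & iexp
  | ISub of iexp & iexp           (* truncated at 0 *)
  | IHalf of iexp.

Inductive rexp : Type :=
  | RConst of int
  | RGet of nat & iexp            (* real array, index *)
  | RAdd of rexp & rexp
  | RSub of rexp & rexp
  | RMul of rexp & rexp
  | RDiv of rexp & rexp.

Inductive bexp : Type :=
  | BILe of iexp & iexp
  | BRLe of rexp & rexp
  | BNot of bexp
  | BAnd of bexp & bexp.

Inductive cmd : Type :=
  | Skip
  | ISet of nat & iexp & iexp     (* integer array, index, new value *)
  | RSet of nat & iexp & rexp     (* real array, index, new value *)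
  | Seq of cmd & cmd
  | If of bexp & cmd & cmd
  | While of bexp & cmd.

(** Costs: every constant, memory access, arithmetic operation, comparison and
    connective occurring in an expression counts as one step. *)

Fixpoint icost (e : iexp) : nat :=
  match e with
  | IConst _ => 1
  | IGet _ e1 | IHalf e1 => (icost e1).+1
  | IAdd e1 e2 | ISub e1 e2 => (icost e1 + icost e2).+1
  end.

Fixpoint rcost (e : rexp) : nat :=
  match e with
  | RConst _ => 1
  | RGet _ e1 => (icost e1).+1
  | RAdd e1 e2 | RSub e1 e2 | RMul e1 e2 | RDiv e1 e2 =>
      (rcost e1 + rcost e2).+1
  end.

Fixpoint bcost (b : bexp) : nat :=
  match b with
  | BILe e1 e2 => (icost e1 + icost e2).+1
  | BRLe e1 e2 => (rcost e1 + rcost e2).+1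
  | BNot b1 => (bcost b1).+1
  | BAnd b1 b2 => (bcost b1 + bcost b2).+1
  end.

Section Semantics.
Context {R : realType}.

Record memory : Type := Memory {
  imem : nat -> nat -> nat;       (* imem a i: cell i of integer array a *)
  rmem : nat -> nat -> R          (* rmem a i: cell i of real array a *)
}.

Definition update (V : Type) (m : nat -> nat -> V) (a i : nat) (x : V) :=
  fun b j => if (b == a) && (j == i) then x else m b j.

Definition iset (s : memory) (a i x : nat) : memory :=
  Memory (update (imem s) a i x) (rmem s).

Definition rset (s : memory) (a i : nat) (x : R) : memory :=
  Memory (imem s) (update (rmem s) a i x).

Fixpoint ieval (s : memory) (e : iexp) : nat :=
  match e with
  | IConst k => k
  | IGet a e1 => imem s a (ieval s e1)
  | IAdd e1 e2 => (ieval s e1 + ieval s e2)%N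
  | ISub e1 e2 => (ieval s e1 - ieval s e2)%N
  | IHalf e1 => (ieval s e1)./2
  end.

(** Division by zero returns zero; as a divisor can be compared with zero
    beforehand, this gives no extra power. *)
Fixpoint reval (s : memory) (e : rexp) : R :=
  match e with
  | RConst z => z%:~R
  | RGet a e1 => rmem s a (ieval s e1)
  | RAdd e1 e2 => reval s e1 + reval s e2
  | RSub e1 e2 => reval s e1 - reval s e2
  | RMul e1 e2 => reval s e1 * reval s e2
  | RDiv e1 e2 => reval s e1 / reval s e2
  end.

Fixpoint beval (s : memory) (b : bexp) : bool :=
  match b with
  | BILe e1 e2 => (ieval s e1 <= ieval s e2)%N
  | BRLe e1 e2 => reval s e1 <= reval s e2
  | BNot b1 => ~~ beval s b1
  | BAnd b1 b2 => beval s b1 && beval s b2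
  end.

(** [exec p s c s']: started in [s], the program [p] halts in [s'] after [c]
    steps. The relation is functional in [c] and [s']. *)
Inductive exec : cmd -> memory -> nat -> memory -> Prop :=
  | ExecSkip s :
      exec Skip s 1 s
  | ExecISet s a e1 e2 :
      exec (ISet a e1 e2) s (icost e1 + icost e2).+1
        (iset s a (ieval s e1) (ieval s e2))
  | ExecRSet s a e1 e2 :
      exec (RSet a e1 e2) s (icost e1 + rcost e2).+1
        (rset s a (ieval s e1) (reval s e2))
  | ExecSeq p q s1 s2 s3 c d :
      exec p s1 c s2 -> exec q s2 d s3 -> exec (Seq p q) s1 (c + d) s3
  | ExecIfTrue b p q s s' c :
      beval s b -> exec p s c s' -> exec (If b p q) s (bcost b + c).+1 s'
  | ExecIfFalse b p q s s' c :
      ~~ beval s b -> exec q s c s' -> exec (If b p q) s (bcost b + c).+1 s'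
  | ExecWhileStop b p s :
      ~~ beval s b -> exec (While b p) s (bcost b).+1 s
  | ExecWhileStep b p s1 s2 s3 c d :
      beval s1 b -> exec p s1 c s2 -> exec (While b p) s2 d s3 ->
      exec (While b p) s1 (bcost b + c + d).+1 s3.

(** Input: the number [n] of intervals in cell 0 of integer array 0, the
    partition points [t_0, ..., t_n] in real array 0, the [n] values in real
    array 1; every other cell holds zero. *)
Definition input_memory (t v : seq R) : memory :=
  Memory (fun a i => if (a == 0) && (i == 0) then size v else 0)%N
         (fun a i => if a == 0%N then t`_i else if a == 1%N then v`_i else 0).

(** Output: a finite sequence, its length in cell 0 of integer array 1 and its
    entries in real array 2. *)
Definition output_of (s : memory) : seq R :=
  mkseq (rmem s 2) (imem s 1 0).

End Semantics.
Arguments memory : clear implicits.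

(* Main.v *)
Require Import Defs.
From HB Require Import structures.
From mathcomp Require Import all_boot all_order all_algebra.
From mathcomp Require Import all_classical all_reals all_analysis.
From mathcomp Require Import zify ring lra.
Import Order.TTheory GRing.Theory Num.Theory.
Import numFieldNormedType.Exports.
Local Open Scope classical_set_scope.
Local Open Scope ring_scope.

Set Implicit Arguments.
Unset Strict Implicit.
Unset Printing Implicit Defensive.

(** Let [F] be the primitive of [f]. For a radius [al], consider the
    piecewise linear string through the points [F b + al * eps b], where [b]
    runs over a set of knots and [eps b] is 1 at a convex kink, -1 at a
    concave one, 0 at the left end and 1 at the right end. If its kinks have
    the signs announced by [eps], then every [g] at distance less than [al]
    from [f] has, on each block between two knots which is a local maximum
    (minimum) of the slope of the string, a value above (below) that slope;
    so [g] has at least as many modes as the string. If moreover the string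
    stays within [al] of [F], its slope is a competitor for the signatures.
    As [al] grows, the bend at a knot changes linearly and its absolute value
    never increases. When a bend vanishes, its knot is deleted; the string is
    unchanged, so both properties persist, and signatures are read off
    whenever the number of modes drops. There are at most [n] deletions, each
    changing the vanishing time of two other knots only, and a tournament tree
    over these times finds the next one in logarithmic time. *)

(** * Integrals of step functions *)

(** The values of [eps] at the two ends encode the boundary conditions. Both primitives vanish at 0,
    so the string is pinned there. At 1 the primitive of a competitor is free, and a rise towards
    the right end costs no mode, because only interior points of a partition can be modes; so the
    string may end on the upper boundary of the tube, which works against a final descent. A
    signature comes out exactly because two bounds meet at the same radius: at an event the string
    with the knots before the deletion still gives the lower bound, and the string with the knots
    after it gives the upper bound. Vanishing times are stored as inverses. A bend that never
    vanishes then has the finite value 0, the next event is a maximum, and the ends and the deleted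
    knots also get 0 from the same formula, thanks to the conventions on their links. *)

Section StepIntegral.
Context {R : realType}.
Implicit Types (f : R -> R) (a b c x : R).
Local Notation mu := (@completed_lebesgue_measure R).
Local Notation Leb := (caratheodory_type (@wlength R idfun)^*%mu).

(** Measurability and boundedness travel with the value: they justify splitting the integral over
    adjacent intervals, and both are needed again for membership in [calL]. *)
Definition has_int f a b (I : R) : Prop :=
  [/\ lebesgue_measurable_fun `[a, b] f,
      exists M, forall x, x \in `[a, b] -> `|f x| <= M
    & \int[mu]_(s in `[a, b]) f s = I].

Lemma measurable_itv_cara (i : interval R) :
  measurable ([set` i] : set Leb).
Proof. by apply: sub_caratheodory; exact: measurable_itv. Qed.

Lemma completed_lebesgue_itv (i : interval R) :
  mu [set` i] = (if i.1 < i.2 then (i.2 : \bar R) - i.1 else 0)%E.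
Proof. exact: lebesgue_measure_itv. Qed.

Lemma measurable_set1_cara x : measurable ([set x] : set Leb).
Proof. by apply: sub_caratheodory; exact: measurable_set1. Qed.

Lemma completed_lebesgue_set1 x : mu [set x] = 0%E.
Proof. exact: lebesgue_measure_set1. Qed.

Lemma bounded_measurable_integrable f a b M :
  lebesgue_measurable_fun `[a, b] f ->
  (forall x, x \in `[a, b] -> `|f x| <= M) ->
  mu.-integrable `[a, b] (EFin \o f).
Proof.
move=> mf fM; apply: measurable_bounded_integrable => //.
- exact: measurable_itv_cara.
- rewrite [ltLHS](completed_lebesgue_itv `[a, b])/=.
  by case: ifP => // _; rewrite -EFinB ltry.
- exists M; split; first exact: num_real.
  by move=> y My x /= xab; rewrite (le_trans _ (ltW My))// fM.
Qed.

Lemma has_int_cst f a b c : a <= b ->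
  (forall x, x \in `]a, b[ -> f x = c) -> has_int f a b (c * (b - a)).
Proof.
move=> ab fc.
(* Nothing is known about [f] at [a] and [b]; they are split off as a null set of at most two
   points, on each of which any function is measurable. *)
pose N : set Leb := [set a] `|` [set b].
have mN : measurable N by apply: measurableU; exact: measurable_set1_cara.
have N0 : mu N = 0%E.
  apply/eqP; rewrite eq_le measure_ge0 andbT.
  apply: (le_trans (measureU2 _ _ _)); [exact: measurable_set1_cara..|].
  by rewrite [X in (X + _)%E](completed_lebesgue_set1 a) [X in (_ + X)%E](completed_lebesgue_set1 b) adde0.
have mI : measurable (`[a, b]%classic : set Leb) by exact: measurable_itv_cara.
have mO : measurable (`]a, b[%classic : set Leb) by exact: measurable_itv_cara.
have DN : `[a, b] `\` N = `]a, b[%classic.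
  apply/seteqP; split=> x /=; rewrite /N/= !in_itv/=.
    move=> [/andP[ax xb]] /not_orP[/eqP xa /eqP xb'].
    by rewrite !lt_neqAle eq_sym xa xb' ax xb.
  move=> /andP[ax xb]; split; first by rewrite !ltW.
  by case=> e; move: ax xb; rewrite e ltxx.
have mfO : measurable_fun (`]a, b[%classic : set Leb) f.
  apply: (eq_measurable_fun (cst c)) => //.
  by move=> x; rewrite inE => /= /fc ->.
have mf : measurable_fun (`[a, b]%classic : set Leb) f.
  have -> : `[a, b]%classic = `]a, b[ `|` (`[a, b] `&` N).
    by rewrite -DN setUC; exact/esym/setUIDK.
  apply/measurable_funU => //; first exact: measurableI.
  split=> //; apply: (@measurable_funS _ _ _ _ N) => //.
  apply/measurable_funU; [exact: measurable_set1_cara..|].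
  by split; exact: measurable_fun_set1.
have [M fM] : exists M, forall x, x \in `[a, b] -> `|f x| <= M.
  exists (`|c| + `|f a| + `|f b|) => x; rewrite in_itv/= => /andP[ax xb].
  have := normr_ge0 c; have := normr_ge0 (f a); have := normr_ge0 (f b).
  have [->|xa] := eqVneq x a; first lra.
  have [->|xb'] := eqVneq x b; first lra.
  by rewrite (fc x); [lra|rewrite in_itv/= !lt_neqAle eq_sym xa xb' ax xb].
split=> //; first by exists M.
have If := bounded_measurable_integrable mf fM.
rewrite /Rintegral (negligible_integral mN mI If N0) DN.
rewrite -/(Rintegral _ _ _) (@eq_Rintegral _ _ _ _ _ (cst c)); last first.
  by move=> x; rewrite inE => /= /fc ->.
rewrite Rintegral_cst// [X in fine X](completed_lebesgue_itv `]a, b[)/= lte_fin.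
by case: ifPn => //= ; rewrite -leNgt => ba; rewrite (@le_anti _ _ a b) ?ab ?ba// subrr.
Qed.

Lemma has_int_cat f a b c I J : a <= b -> b <= c ->
  has_int f a b I -> has_int f b c J -> has_int f a c (I + J).
Proof.
move=> ab bc [mf [M fM] fI] [mg [N gN] gJ].
have acE : `[a, c]%classic = `[a, b] `|` `]b, c].
  apply/seteqP; split=> x /=; rewrite !in_itv/=; case: (leP x b) => xb; rewrite ?andbT ?andbF/=.
  - by move=> /andP[-> _]; left.
  - by move=> /andP[_ ->]; right.
  - by case=> // ->; rewrite (le_trans xb bc).
  - by case=> // ->; rewrite (le_trans ab (ltW xb)).
have bcE : `[b, c]%classic = [set b] `|` `]b, c].
  by rewrite setU1itv// bnd_simp.
have m1 : measurable ([set b] : set Leb) by exact: measurable_set1_cara.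
have m2 : measurable (`]b, c]%classic : set Leb) by exact: measurable_itv_cara.
have m3 : measurable (`[a, b]%classic : set Leb) by exact: measurable_itv_cara.
have mgO : measurable_fun (`]b, c]%classic : set Leb) f.
  by move: (mg); rewrite /lebesgue_measurable_fun bcE => /measurable_funU; case.
have mfg : lebesgue_measurable_fun `[a, c] f.
  by rewrite /lebesgue_measurable_fun acE; apply/measurable_funU.
have K x : x \in `[a, c] -> `|f x| <= `|M| + `|N|.
  rewrite in_itv/= => /andP[ax xc]; have := ler_norm M; have := ler_norm N.
  have := normr_ge0 M; have := normr_ge0 N.
  have [xb|bx] := leP x b.
    by have := fM x; rewrite in_itv/= ax xb => /(_ isT); lra.
  by have := gN x; rewrite in_itv/= (ltW bx) xc => /(_ isT); lra.
split=> //; first by exists (`|M| + `|N|).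
have Ifg := bounded_measurable_integrable mfg K.
have Ig := bounded_measurable_integrable mg gN.
rewrite acE Rintegral_setU//; last 2 first.
- by rewrite -acE.
- rewrite disj_set2E; apply/eqP/seteqP; split=> x //=; rewrite !in_itv/=.
  by move=> [/andP[_ xb] /andP[bx _]]; move: (le_lt_trans xb bx); rewrite ltxx.
rewrite fI; congr (_ + _); rewrite -gJ bcE Rintegral_setU//; last 2 first.
- by rewrite -bcE.
- rewrite disj_set2E; apply/eqP/seteqP; split=> x //=; rewrite !in_itv/=.
  by move=> [->]; rewrite ltxx.
rewrite [X in _ = X + _](_ : _ = 0) ?add0r//.
apply: (congr1 fine (y := 0%E)).
apply: null_set_integral m1 _ (completed_lebesgue_set1 b).
exact: measurable_fun_set1.
Qed.

End StepIntegral.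

Section StepFunctions.
Context {R : realType} (t : seq R) (n : nat).
Hypotheses (t01 : unit_partition t) (size_t : size t = n.+1).
Implicit Types (f g h : R -> R) (d : nat -> R) (x : R).

Lemma partition_first : t`_0 = 0.
Proof.
by have /and3P[_ /eqP] := t01; move: size_t; case: t => //= a s _ ->.
Qed.

Lemma partition_last : t`_n = 1.
Proof.
by have /and3P[_ _ /eqP] := t01; move: size_t; case: t => //= a s [<-] <-; rewrite nth_last.
Qed.

Lemma partition_lt i j : (i < j)%N -> (j <= n)%N -> t`_i < t`_j.
Proof.
move=> ij jn; have /and3P[st _ _] := t01.
by apply: (sorted_ltn_nth lt_trans) => //; rewrite inE size_t ltnS //; lia.
Qed.

Lemma partition_le i j : (i <= j)%N -> (j <= n)%N -> t`_i <= t`_j.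
Proof.
by rewrite leq_eqVlt => /predU1P[->//|ij] jn; rewrite ltW// partition_lt.
Qed.

Lemma partition_ge0 j : (j <= n)%N -> 0 <= t`_j.
Proof. by move=> jn; have := partition_le (leq0n j) jn; rewrite partition_first. Qed.

Lemma partition_le1 j : (j <= n)%N -> t`_j <= 1.
Proof. by move=> jn; have := partition_le jn (leqnn n); rewrite partition_last. Qed.

Lemma partition_cell x : 0 <= x <= 1 -> (0 < n)%N ->
  exists2 j, (j < n)%N & t`_j <= x <= t`_j.+1.
Proof.
move=> /andP[x0 x1] n0.
suff H k : (0 < k <= n)%N -> x <= t`_k -> exists2 j, (j < n)%N & t`_j <= x <= t`_j.+1.
  by apply: (H n); rewrite ?partition_last ?n0/=.
elim: k => [//|k IH] kn xk.
have [tx|xt] := leP t`_k x; first by exists k; [lia|rewrite tx].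
case: k => [|k] in IH kn xk xt *; last by apply: IH; [lia|exact: ltW].
by move: xt; rewrite partition_first ltNge x0.
Qed.

Definition cell_sum d j : R := \sum_(i < j) d i * (t`_i.+1 - t`_i).

Lemma cell_sumS d j : cell_sum d j.+1 = cell_sum d j + d j * (t`_j.+1 - t`_j).
Proof. by rewrite /cell_sum big_ord_recr. Qed.

Definition step_values h d :=
  forall i, (i < n)%N -> forall x, x \in `]t`_i, t`_i.+1[ -> h x = d i.

Lemma has_int_step h d j : step_values h d -> (j <= n)%N ->
  has_int h 0 t`_j (cell_sum d j).
Proof.
move=> hd; elim: j => [_|j IH jn].
  have := @has_int_cst _ h 0 0 0 (lexx _); rewrite partition_first mul0r /cell_sum big_ord0.
  by apply=> x; rewrite in_itv/= => /andP[x0 /(lt_trans x0)]; rewrite ltxx.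
rewrite cell_sumS; apply: has_int_cat (IH (ltnW jn)) _.
- by rewrite partition_ge0// ltnW.
- by rewrite partition_le.
- by apply: has_int_cst; [rewrite partition_le|exact: hd].
Qed.

Lemma has_int_step_cell h d j x : step_values h d -> (j < n)%N ->
  t`_j <= x <= t`_j.+1 -> has_int h 0 x (cell_sum d j + d j * (x - t`_j)).
Proof.
move=> hd jn /andP[tx xt]; apply: has_int_cat (has_int_step hd (ltnW jn)) _.
- by rewrite partition_ge0// ltnW.
- by [].
- apply: has_int_cst => // y; rewrite in_itv/= => /andP[ty yx]; apply: hd => //.
  by rewrite in_itv/= ty (lt_le_trans yx xt).
Qed.

Lemma interpolation_bound (p d x a b M : R) : a <= x <= b ->
  `|p| <= M -> `|p + d * (b - a)| <= M -> `|p + d * (x - a)| <= M.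
Proof.
move=> /andP[ax xb]; rewrite !ler_norml => /andP[p1 p2] /andP[q1 q2].
by have [d0|d0] := leP 0 d; apply/andP; split; nra.
Qed.

(** The difference of the primitives is affine on each cell, so its absolute value is largest at a
    partition point. *)
Lemma dK_le f g d M : (0 < n)%N -> step_values (fun s => f s - g s) d ->
  dK f g <= M <-> forall j, (j <= n)%N -> `|cell_sum d j| <= M.
Proof.
move=> n0 hd.
have ub K : (forall j, (j <= n)%N -> `|cell_sum d j| <= K) ->
    ubound [set `|\int[completed_lebesgue_measure]_(s in `[0, x]) (f s - g s)|
      | x in `[0, 1]] K.
  move=> HK _ [x /= x01 <-]; rewrite in_itv/= in x01.
  have [j jn tx] := partition_cell x01 n0.
  have [_ _ ->] := has_int_step_cell hd jn tx.
  apply: interpolation_bound tx _ _; first by apply: HK; lia.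
  by rewrite -cell_sumS; exact: HK.
split=> [dM j jn|HM]; last first.
  apply: ge_sup (ub _ HM).
  exists `|\int[completed_lebesgue_measure]_(s in `[0, 0]) (f s - g s)|, 0 => //=.
  by rewrite in_itv/= lexx ler01.
apply: le_trans dM; apply: ub_le_sup.
  (* A supremum dominates its elements only once the set is known to be bounded; the sum of all
     candidates is a crude bound. *)
  exists (\sum_(i < n.+1) `|cell_sum d i|); apply: ub => i ni.
  rewrite (bigD1 (Ordinal (ni : (i < n.+1)%N)))//= lerDl sumr_ge0//.
exists t`_j; last by have [_ _ ->] := has_int_step hd jn.
by rewrite /= in_itv/= partition_ge0// partition_le1.
Qed.

End StepFunctions.

(** * The step function with given cell values *)

Section StepFunctionOf.
Context {R : realType} (t : seq R) (n : nat).
Hypotheses (t01 : unit_partition t) (size_t : size t = n.+1).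
Implicit Types (w : nat -> R) (x y : R).

(** Counting the partition points before [x], strictly here and weakly in [rcell], gives the index
    of the cell just left or just right of [x]. Only interior points are counted, so both indices
    agree at 0 and at 1, where [calL] prescribes the adjacent value. *)
Definition lcell x : nat := \sum_(1 <= i < n) (t`_i < x)%R.
Definition rcell x : nat := \sum_(1 <= i < n) (t`_i <= x)%R.
Definition step_of w x : R := (w (lcell x) + w (rcell x)) / 2.

Lemma sum_ltn_index (P : pred nat) j : (j < n)%N ->
  (forall i, (0 < i < n)%N -> P i = (i <= j)%N) -> (\sum_(1 <= i < n) P i)%N = j.
Proof.
move=> jn HP; rewrite (@big_cat_nat _ _ _ j.+1)//=.
rewrite [X in (_ + X)%N](eq_big_nat _ _ (F2 := fun=> 0%N)) => [|i /andP[ji ni]]; last first.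
  by rewrite HP; lia.
rewrite (eq_big_nat _ _ (F2 := fun=> 1%N)) => [|i /andP[i1 ij]]; last by rewrite HP; lia.
by rewrite !sum_nat_const_nat; lia.
Qed.

Lemma lcellP x j : (j < n)%N -> (forall i, (0 < i < n)%N -> (t`_i < x) = (i <= j)%N) ->
  lcell x = j.
Proof. exact: sum_ltn_index. Qed.

Lemma rcellP x j : (j < n)%N -> (forall i, (0 < i < n)%N -> (t`_i <= x) = (i <= j)%N) ->
  rcell x = j.
Proof. exact: sum_ltn_index. Qed.

Lemma lcell_in j x : (j < n)%N -> x \in `]t`_j, t`_j.+1[ -> lcell x = j.
Proof.
rewrite in_itv/= => jn /andP[tx xt]; apply: lcellP => // i /andP[i0 ni].
case: leqP => ij; last first.
  by apply/negbTE; rewrite -leNgt (le_trans (ltW xt))// (partition_le t01 size_t)// ltnW.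
by rewrite (le_lt_trans _ tx)// (partition_le t01 size_t)//; lia.
Qed.

Lemma rcell_in j x : (j < n)%N -> x \in `]t`_j, t`_j.+1[ -> rcell x = j.
Proof.
rewrite in_itv/= => jn /andP[tx xt]; apply: rcellP => // i /andP[i0 ni].
case: leqP => ij; last first.
  by apply/negbTE; rewrite -ltNge (lt_le_trans xt)// (partition_le t01 size_t)// ltnW.
by rewrite (le_trans _ (ltW tx))// (partition_le t01 size_t)//; lia.
Qed.

Lemma step_of_values w : step_values t n (step_of w) w.
Proof.
move=> i ni x xi; rewrite /step_of (lcell_in ni xi) (rcell_in ni xi); lra.
Qed.

Lemma lcell_le_rcell x : (lcell x <= rcell x)%N.
Proof. by apply: leq_sum => i _; case: (ltP t`_i x) => // /ltW ->. Qed.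

Lemma rcell_lt_n x : (0 < n)%N -> (rcell x < n)%N.
Proof.
move=> n0; apply: (@leq_ltn_trans (\sum_(1 <= i < n) 1)%N).
  by apply: leq_sum => i _; case: (_ <= x).
by rewrite sum_nat_const_nat muln1; lia.
Qed.

Lemma rcell_le_lcell x y : x < y -> (rcell x <= lcell y)%N.
Proof. by move=> xy; apply: leq_sum => i _; case: (leP t`_i x) => // tx; rewrite (le_lt_trans tx xy). Qed.

(** The two counts differ by the number of partition points equal to [x], and these are pairwise
    distinct. *)
Lemma rcell_le_lcellS x : (rcell x <= (lcell x).+1)%N.
Proof.
have [n0|n0] := posnP n; first by rewrite /rcell big_geq//; lia.
have K : (rcell x <= \sum_(1 <= i < n) ((t`_i < x)%R + (t`_i == x)%R))%N.
  by apply: leq_sum => i _; case: (@ltgtP _ R t`_i x).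
move: K; rewrite big_split/= -/(lcell x) => K.
apply: leq_trans K _; rewrite -[(lcell x).+1]addn1 leq_add2l.
case: (boolP [exists i : 'I_n, (0 < i)%N && (t`_i == x)%R]) => [/existsP[i /andP[i0 /eqP tix]]|/existsPn N].
  rewrite (bigD1_seq (i : nat)) ?iota_uniq// ?mem_index_iota ?i0 ?ltn_ord//=.
  rewrite tix eqxx big1_seq ?addn0// => j /andP[ji]; rewrite mem_index_iota => /andP[j0 nj].
  apply/eqP; rewrite eqb0 -tix; apply/negP => /eqP tij.
  have := ltn_ord i; move=> nii.
  have [ij|ij|ij] := ltngtP i j.
  - by have := partition_lt t01 size_t ij (ltnW nj); rewrite tij ltxx.
  - by have := partition_lt t01 size_t ij (ltnW nii); rewrite tij ltxx.
  - by rewrite ij eqxx in ji.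
rewrite big1_seq// => j /=; rewrite mem_index_iota => /andP[j0 nj].
by have := N (Ordinal nj); rewrite /= j0/= => /negbTE ->.
Qed.

Lemma knots_away (s : seq R) x :
  exists2 e, 0 < e & forall y, y \in s -> y != x -> e <= `|y - x|.
Proof.
elim: s => [|a s [e e0 He]]; first by exists 1.
exists (if a == x then e else Num.min e `|a - x|).
  by case: eqVneq => // ax; rewrite lt_min e0 normr_gt0 subr_eq0.
move=> y; rewrite inE => /predU1P[->|ys] yx; first by rewrite (negbTE yx) ge_min lexx orbT.
by case: eqVneq => _; [|rewrite ge_min]; rewrite He.
Qed.

Lemma step_of_local w x : exists2 e, 0 < e & forall y,
  (x - e < y < x -> step_of w y = w (lcell x)) /\
  (x < y < x + e -> step_of w y = w (rcell x)).
Proof.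
have [e e0 He] := knots_away t x; exists e => // y.
have tin i : (0 < i < n)%N -> t`_i \in t.
  by move=> /andP[_ ni]; rewrite mem_nth// size_t ltnS ltnW.
split=> /andP[y1 y2].
- suff [E1 E2] : lcell y = lcell x /\ rcell y = lcell x by rewrite /step_of E1 E2; lra.
  split; apply: eq_big_nat => i /tin ti; congr nat_of_bool.
    apply/idP/idP => H; first exact: lt_trans H y2.
    have := He _ ti; rewrite lt_eqF// => /(_ isT); rewrite ltr0_norm ?subr_lt0//; lra.
  apply/idP/idP => H; first exact: le_lt_trans H y2.
  have := He _ ti; rewrite lt_eqF// => /(_ isT); rewrite ltr0_norm ?subr_lt0//; lra.
- suff [E1 E2] : lcell y = rcell x /\ rcell y = rcell x by rewrite /step_of E1 E2; lra.
  split; apply: eq_big_nat => i /tin ti; congr nat_of_bool.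
    apply/idP/idP => H; last exact: le_lt_trans H y1.
    rewrite leNgt; apply/negP => xt; have := He _ ti; rewrite gt_eqF// => /(_ isT).
    by rewrite gtr0_norm ?subr_gt0//; lra.
  apply/idP/idP => H; last exact: le_trans H (ltW y1).
  rewrite leNgt; apply/negP => xt; have := He _ ti; rewrite gt_eqF// => /(_ isT).
  by rewrite gtr0_norm ?subr_gt0//; lra.
Qed.

Lemma calL_step_of w : (0 < n)%N -> calL (step_of w).
Proof.
move=> n0.
have := has_int_step t01 size_t (step_of_values w) (leqnn n).
rewrite (partition_last t01 size_t) => -[mg [M gM] _].
split=> //; first by exists M; apply: aeW => s /= /gM.
move=> x x01; rewrite in_itv/= in x01; have /andP[x0 x1] := x01.
have [e e0 He] := step_of_local w x.
(* For a radius below [e1] the window sees one value on each side of [x] and is not cut off at 0 or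
   1. The placeholder 1 replaces the constraint from an end at which [x] itself lies. *)
pose e1 := Num.min e (Num.min (if x == 0 then 1 else x) (if x == 1 then 1 else 1 - x)).
have e10 : 0 < e1.
  rewrite /e1 !lt_min e0/=; apply/andP; split; case: eqVneq => // H.
    by rewrite lt_neqAle eq_sym H x0.
  by rewrite subr_gt0 lt_neqAle H x1.
have avg d : 0 < d < e1 -> local_average (step_of w) x d = step_of w x.
  move=> /andP[d0]; rewrite /e1 !lt_min => /and3P[de dx d1].
  rewrite /local_average; set a := Num.max _ _; set b := Num.min _ _.
  have [ax xb] : a <= x /\ x <= b.
    by rewrite /a /b ge_max le_min x0 x1/=; split; lra.
  have [xa bx] : x - d <= a /\ b <= x + d.
    by rewrite /a /b le_max ge_min !lexx !orbT.
  have I1 : has_int (step_of w) a x (w (lcell x) * (x - a)).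
    apply: has_int_cst => // y; rewrite in_itv/= => /andP[ay yx].
    by apply: (He y).1; rewrite yx andbT; lra.
  have I2 : has_int (step_of w) x b (w (rcell x) * (b - x)).
    apply: has_int_cst => // y; rewrite in_itv/= => /andP[xy yb].
    by apply: (He y).2; rewrite xy/=; lra.
  have [_ _ ->] := has_int_cat ax xb I1 I2.
  rewrite /step_of.
  have ab : b - a != 0.
    rewrite subr_eq0 gt_eqF// /a /b.
    by rewrite lt_min !gt_max; apply/andP; split; apply/andP; split; lra.
  have [xE0|xN0] := eqVneq x 0.
    have lr : rcell x = lcell x.
      apply: eq_big_nat => i /andP[i0 ni]; congr nat_of_bool.
      have := partition_lt t01 size_t i0 (ltnW ni); rewrite (partition_first t01 size_t) xE0.
      by move=> ti; rewrite leNgt ti/= [RHS]ltNge ltW.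
    by rewrite lr; field.
  have [xE1|xN1] := eqVneq x 1.
    have lr : rcell x = lcell x.
      apply: eq_big_nat => i /andP[i0 ni]; congr nat_of_bool.
      have := partition_lt t01 size_t ni (leqnn n); rewrite (partition_last t01 size_t) xE1.
      by move=> ti; rewrite ti ltW.
    by rewrite lr; field.
  have aE : a = x - d.
    by rewrite /a max_r//; move: dx; rewrite (negbTE xN0); lra.
  have bE : b = x + d.
    by rewrite /b min_r//; move: d1; rewrite (negbTE xN1); lra.
  by rewrite aE bE; field; rewrite lt0r_neq0//; lra.
apply: cvg_near_cst; near=> z.
have z0 : 0 < z by near: z; exact: nbhs_right_gt.
have ze : z < e1 by near: z; exact: nbhs_right_lt.
rewrite (_ : [set _ | _ in _] = [set step_of w x]) ?inf1//.
apply/seteqP; split=> y /=.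
  move=> [d]; rewrite in_itv/= => /andP[d0 dz] <-; apply: avg.
  by rewrite d0 (lt_trans dz ze).
move=> ->; exists (z / 2); first by rewrite in_itv/=; lra.
by apply: avg; lra.
Unshelve. all: by end_near.
Qed.

Lemma stepX_step_of w : (0 < n)%N -> stepX t (step_of w).
Proof.
move=> n0; split; first exact: calL_step_of.
by move=> i; rewrite size_t ltnS => ni; exists (w i) => x; exact: step_of_values.
Qed.

End StepFunctionOf.

(** * Knots and the modes of a step function *)

Section Knots.
Context {R : realType}.
Implicit Types (eps w : nat -> R) (nxt prv : nat -> nat).

(** The left end is a knot although its sign is 0; every other knot is recognised by its nonzero
    sign, so the set of knots need not be stored. *)
Definition alive eps b := (b == 0)%N || (eps b != 0).

Record linked (n : nat) eps nxt prv : Prop := Linked {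
  nxtP : forall b, alive eps b -> (b < n)%N ->
    [/\ (b < nxt b <= n)%N, alive eps (nxt b), prv (nxt b) = b
      & forall j, (b < j < nxt b)%N -> eps j = 0];
  prvP : forall b, alive eps b -> (0 < b <= n)%N ->
    [/\ (prv b < b)%N, alive eps (prv b) & nxt (prv b) = b]
}.

Record knots (n : nat) eps nxt prv : Prop := Knots {
  knots_linked :> linked n eps nxt prv;
  eps_first : eps 0%N = 0;
  eps_last : eps n = 1;
  eps_sign : forall j, [\/ eps j = 0, eps j = 1 | eps j = -1]
}.

(** A block entered by an up jump of the slope and left by a down jump, indexed by its left knot. *)
Definition peak eps nxt b := (eps b == 1) && (eps (nxt b) == -1).

Definition npeaks n eps nxt : nat := \sum_(0 <= b < n) peak eps nxt b.

Lemma alive_neq0 eps b : eps b != 0 -> alive eps b.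
Proof. by rewrite /alive => ->; rewrite orbT. Qed.

Lemma one_eqN1 : (1 == -1 :> R) = false.
Proof. by rewrite -subr_eq0 opprK paddr_eq0// oner_eq0. Qed.

Section Peaks.
Context (n : nat) (eps : nat -> R) (nxt prv : nat -> nat).
Hypothesis K : knots n eps nxt prv.

(** A walk along the links starting at the up knot [p] cannot jump over the live knot [q], so one of
    its steps leads from an up knot to a down knot. *)
Lemma peak_between p q : (p < q <= n)%N -> eps p = 1 -> eps q = -1 ->
  exists b, [/\ (p <= b)%N, peak eps nxt b & (b < nxt b <= q)%N].
Proof.
move=> + + eq; move: {2}(q - p)%N (leqnn (q - p)%N) => k.
elim: k p => [|k IH] p qpk /andP[pq qn] ep; first lia.
have ap : alive eps p by apply: alive_neq0; rewrite ep oner_eq0.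
have [/andP[pn nn] an _ z] := nxtP K ap (leq_trans pq qn).
have nq : (nxt p <= q)%N.
  rewrite leqNgt; apply/negP => qn'; have := z q; rewrite pq qn' => /(_ isT).
  by rewrite eq => /eqP; rewrite oppr_eq0 oner_eq0.
have [e0|e1|e1] := eps_sign K (nxt p).
- by move: an; rewrite /alive e0 eqxx orbF => /eqP np; rewrite np in pn.
- have [||b [pb mb bq]] := IH (nxt p) _ _ e1; first lia.
    rewrite qn andbT ltn_neqAle nq andbT; apply/eqP => npq.
    by move: e1; rewrite npq eq => /eqP; rewrite eq_sym one_eqN1.
  by exists b; split=> //; lia.
- by exists p; split=> //; [rewrite /peak ep e1 !eqxx|rewrite pn].
Qed.

(** Peaks are counted by where they end, so that a peak found inside a range of knots is new
    compared with those counted to the left of the range. *)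
Definition peaks_upto j : nat := \sum_(0 <= b < n) (peak eps nxt b && (nxt b <= j)%N).

Lemma peaks_upto_le i j : (i <= j)%N -> (peaks_upto i <= peaks_upto j)%N.
Proof.
move=> ij; apply: leq_sum => b _; case: peak => //=.
by case: (leqP (nxt b) i) => // bi; rewrite (leq_trans bi ij).
Qed.

Lemma peaks_upto_npeaks j : (peaks_upto j <= npeaks n eps nxt)%N.
Proof. by apply: leq_sum => b _; case: peak => //=; exact: leq_b1. Qed.

Lemma peaks_upto_lt i j p q : (i <= p)%N -> (p < q)%N -> (q <= j)%N -> (q <= n)%N ->
  eps p = 1 -> eps q = -1 -> (peaks_upto i < peaks_upto j)%N.
Proof.
move=> ip pq qj qn ep eq.
have [b [pb mb /andP[bnb bq]]] : exists b, [/\ (p <= b)%N, peak eps nxt b & (b < nxt b <= q)%N].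
  by apply: peak_between; rewrite ?pq.
have bn : (b < n)%N by lia.
rewrite /peaks_upto (bigD1_seq b) ?iota_uniq ?mem_index_iota//=.
rewrite [X in (_ < X)%N](bigD1_seq b) ?iota_uniq ?mem_index_iota//=.
rewrite mb /= (leq_trans bq qj) [(nxt b <= i)%N]leqNgt.
have -> /= : (i < nxt b)%N by lia.
rewrite ltnS add0n; apply: leq_sum => c _.
by case: peak => //=; case: (leqP (nxt c) i) => // ci; rewrite (leq_trans ci)//; lia.
Qed.

(** * Modes of a step function whose jumps follow the signs of the knots *)

Section StepModes.
Context (w : nat -> R).
Hypotheses (w0 : forall j, (0 < j < n)%N -> eps j = 0 -> w j = w j.-1)
  (w_up : forall j, (0 < j < n)%N -> eps j = 1 -> w j.-1 <= w j)
  (w_down : forall j, (0 < j < n)%N -> eps j = -1 -> w j <= w j.-1).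

Lemma nonincreasing_without_up i j : (i <= j < n)%N ->
  (forall k, (i < k <= j)%N -> eps k != 1) -> w j <= w i.
Proof.
move=> /andP[]; elim: j => [|j IH] ij jn H; first by move: ij; rewrite leqn0 => /eqP ->.
move: ij; rewrite leq_eqVlt => /predU1P[->//|ij].
apply: (@le_trans _ _ (w j)); last first.
  by apply: IH => //; [lia|move=> k kj; apply: H; lia].
have [e|/eqP|e] := eps_sign K j.+1.
- by rewrite (@w0 j.+1).
- by rewrite (negbTE (H _ _))//; lia.
- exact: w_down.
Qed.

Lemma nondecreasing_without_down i j : (i <= j < n)%N ->
  (forall k, (i < k <= j)%N -> eps k != -1) -> w i <= w j.
Proof.
move=> /andP[]; elim: j => [|j IH] ij jn H; first by move: ij; rewrite leqn0 => /eqP ->.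
move: ij; rewrite leq_eqVlt => /predU1P[->//|ij].
apply: (@le_trans _ _ (w j)).
  by apply: IH => //; [lia|move=> k kj; apply: H; lia].
have [e|e|/eqP] := eps_sign K j.+1.
- by rewrite (@w0 j.+1).
- exact: (@w_up j.+1).
- by rewrite (negbTE (H _ _))//; lia.
Qed.

Context (t : seq R).
Hypotheses (t01 : unit_partition t) (size_t : size t = n.+1) (n0 : (0 < n)%N).
Local Notation g := (step_of t n w).
Local Notation lc := (lcell t n).
Local Notation rc := (rcell t n).

Lemma up_of_lt x y : x < y -> g x < g y ->
  exists2 k, (lc x < k <= rc y)%N & eps k = 1.
Proof.
move=> xy gxy; apply: contrapT => /forall2NP N.
have {}N k : (lc x < k <= rc y)%N -> eps k != 1.
  by move=> H; apply/eqP; case: (N k).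
have rl : (rc x <= lc y)%N by exact: rcell_le_lcell.
have lrx : (lc x <= rc x)%N by exact: lcell_le_rcell.
have lry : (lc y <= rc y)%N by exact: lcell_le_rcell.
have ryn : (rc y < n)%N by exact: rcell_lt_n.
have : w (rc y) <= w (lc x) by apply: nonincreasing_without_up => //; lia.
have : w (lc y) <= w (rc x).
  by apply: nonincreasing_without_up => [|k H]; [lia|apply: N; lia].
by move: gxy; rewrite /step_of; lra.
Qed.

Lemma down_of_gt x y : x < y -> g y < g x ->
  exists2 k, (lc x < k <= rc y)%N & eps k = -1.
Proof.
move=> xy gxy; apply: contrapT => /forall2NP N.
have {}N k : (lc x < k <= rc y)%N -> eps k != -1.
  by move=> H; apply/eqP; case: (N k).
have rl : (rc x <= lc y)%N by exact: rcell_le_lcell.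
have lrx : (lc x <= rc x)%N by exact: lcell_le_rcell.
have lry : (lc y <= rc y)%N by exact: lcell_le_rcell.
have ryn : (rc y < n)%N by exact: rcell_lt_n.
have : w (lc x) <= w (rc y) by apply: nondecreasing_without_down => //; lia.
have : w (rc x) <= w (lc y).
  by apply: nondecreasing_without_down => [|k H]; [lia|apply: N; lia].
by move: gxy; rewrite /step_of; lra.
Qed.

(* Modes of [g] at different indices lie over disjoint ranges of knots, and each
   range contains a peak. *)
Lemma modes_on_step_of_le u : unit_partition u ->
  (modes_on g u <= npeaks n eps nxt)%N.
Proof.
move=> u01.
case E : (size u) => [|N]; first by rewrite /modes_on E big_geq.
pose md i := Num.max (g u`_i.-1) (g u`_i.+1) < g u`_i.
have mdP i : md i = (g u`_i.-1 < g u`_i) && (g u`_i.+1 < g u`_i).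
  by rewrite /md gt_max.
have ult i : (i < N)%N -> u`_i < u`_i.+1.
  by move=> iN; apply: (partition_lt u01 E).
suff H i : (i < N)%N -> (\sum_(1 <= k < i.+1) md k <= peaks_upto (rc u`_i.+1))%N.
  case: N => [|N] in E ult H *; first by rewrite /modes_on E big_geq.
  rewrite /modes_on E /=; apply: leq_trans (peaks_upto_npeaks (rc u`_N.+1)).
  exact: H.
elim/ltn_ind: i => i IH iN.
case: i => [|i] in IH iN *; first by rewrite big_geq.
rewrite big_nat_recr//=.
have [mi|nmi] := boolP (md i.+1); last first.
  rewrite addn0; apply: leq_trans (IH i (leqnn _) (ltnW iN)) _.
  apply: peaks_upto_le; apply: leq_trans (lcell_le_rcell _ _ _).
  by apply: rcell_le_lcell; exact: ult.
move: (mi); rewrite mdP => /andP[/= m1 m2].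
have [p /andP[p1 p2] ep] := up_of_lt (ult i (ltnW iN)) m1.
have [q /andP[q1 q2] eq] := down_of_gt (ult i.+1 iN) m2.
(* The ranges containing [p] and [q] share at most the knot located at the mode itself, whose sign
   cannot be both 1 and -1. *)
have pq : (p < q)%N.
  have : (rc u`_i.+1 <= (lc u`_i.+1).+1)%N := rcell_le_lcellS t01 size_t _.
  have : p != q.
    by apply/eqP => E'; move: ep; rewrite E' eq => /eqP; rewrite eq_sym one_eqN1.
  lia.
have ryn : (rc u`_i.+2 < n)%N by exact: rcell_lt_n.
apply: (@leq_trans (peaks_upto (rc u`_i)).+1); last first.
  apply: (@peaks_upto_lt _ _ p q) => //; last by lia.
  by apply: leq_trans (rcell_le_lcellS t01 size_t _) _.
(* Two consecutive indices cannot both be modes, so the induction goes back two indices; this leaves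
   the range from [p] to [q] free for the new peak. *)
rewrite addn1 ltnS.
case: i => [|i] in IH iN mi m1 m2 p1 p2 q1 q2 pq ryn *; first by rewrite big_geq.
rewrite big_nat_recr//= [md i.+1](_ : _ = false) ?addn0; last first.
  by apply/negbTE; rewrite mdP/= negb_and -!leNgt (ltW m1) orbT.
by apply: IH; lia.
Qed.

Lemma modes_step_of_le : (modes g <= (npeaks n eps nxt)%:R%:E)%E.
Proof.
apply: ge_ereal_sup => _ [u /= u01 <-]; rewrite lee_fin ler_nat.
exact: modes_on_step_of_le.
Qed.

End StepModes.
End Peaks.
End Knots.

(** * Lower bound on the number of modes *)

Section ModesOfSequence.
Context {R : realType}.
Implicit Types (s : seq R) (g : R -> R).

(** The count of [modes_on] on a list of values, in a form suited to adding values in front. *)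
Fixpoint seq_modes s : nat :=
  if s is x :: s' then
    (if s' is y :: z :: _ then (Num.max x z < y)%R : nat else 0) + seq_modes s'
  else 0.

Lemma seq_modes_cons x s : (seq_modes s <= seq_modes (x :: s))%N.
Proof. exact: leq_addl. Qed.

Lemma seq_modes_peak x y z s : x < y -> z < y ->
  seq_modes [:: x, y, z & s] = (seq_modes [:: y, z & s]).+1.
Proof. by move=> xy zy; rewrite /= gt_max xy zy. Qed.

Lemma seq_modes_rcons s x : (seq_modes s <= seq_modes (rcons s x))%N.
Proof.
elim: s => // a s IH; rewrite rcons_cons /=.
apply: leq_add IH; case: s => // b [|c s] //=.
Qed.

Lemma modes_onE g u : modes_on g u = seq_modes (map g u).
Proof.
rewrite /modes_on; elim: u => [|x u IH]; first by rewrite big_geq.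
case: u IH => [|y [|z u]] IH; [by rewrite big_geq| by rewrite big_geq|].
rewrite /= in IH *; rewrite big_nat_recl//=; congr addn.
by rewrite -IH [RHS]big_add1 big_add1.
Qed.

End ModesOfSequence.

Section LowerBound.
Context {R : realType} (t : seq R) (n : nat).
Hypotheses (t01 : unit_partition t) (size_t : size t = n.+1) (n0 : (0 < n)%N).
Implicit Types (F U v c : nat -> R).

(** The jump of the slope at [j], cleared of denominators: for increasing indices it has the sign of
    that jump, it is linear in [U], and it stays meaningful when indices coincide. *)
Definition bend U i j k := (U k - U j) * (t`_j - t`_i) - (U j - U i) * (t`_k - t`_j).

Definition slope U i j := (U j - U i) / (t`_j - t`_i).

Lemma partition_gap i j : (i < j <= n)%N -> 0 < t`_j - t`_i.
Proof. by move=> /andP[ij jn]; rewrite subr_gt0 (partition_lt t01 size_t). Qed.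

Lemma bendE U i j k : (i < j < k)%N -> (k <= n)%N ->
  bend U i j k = (slope U j k - slope U i j) * ((t`_j - t`_i) * (t`_k - t`_j)).
Proof.
move=> /andP[ij jk] kn.
have : 0 < t`_j - t`_i by rewrite partition_gap// ij; lia.
have : 0 < t`_k - t`_j by rewrite partition_gap// jk.
rewrite /bend /slope => /lt0r_neq0 H1 /lt0r_neq0 H2; field.
by rewrite H1 H2.
Qed.

Lemma bend_ge0 U i j k : (i < j < k)%N -> (k <= n)%N ->
  (0 <= bend U i j k) = (slope U i j <= slope U j k).
Proof.
move=> /[dup] H /andP[ij jk] kn; rewrite bendE// pmulr_lge0 ?subr_ge0//.
by rewrite mulr_gt0// partition_gap// ?ij ?jk//; lia.
Qed.

Lemma bend_le0 U i j k : (i < j < k)%N -> (k <= n)%N ->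
  (bend U i j k <= 0) = (slope U j k <= slope U i j).
Proof.
move=> /[dup] H /andP[ij jk] kn; rewrite bendE// pmulr_lle0 ?subr_le0//.
by rewrite mulr_gt0// partition_gap// ?ij ?jk//; lia.
Qed.

Lemma exists_cell_below c i j s : (i < j <= n)%N ->
  cell_sum t c j - cell_sum t c i < s * (t`_j - t`_i) ->
  exists2 k, (i <= k < j)%N & c k < s.
Proof.
move=> /andP[ij jn] H; apply: contrapT => /forall2NP N.
suff: s * (t`_j - t`_i) <= cell_sum t c j - cell_sum t c i by rewrite leNgt H.
have {}N k : (i <= k < j)%N -> s <= c k.
  by move=> kij; rewrite leNgt; apply/negP; case: (N k).
move: {H ij} (ltnW ij) jn N; elim: j => [|j IH] ij jn N.
  by move: ij; rewrite leqn0 => /eqP ->; rewrite !subrr mulr0.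
move: ij; rewrite leq_eqVlt => /predU1P[->|ij]; first by rewrite !subrr mulr0.
have {}IH : s * (t`_j - t`_i) <= cell_sum t c j - cell_sum t c i.
  by apply: IH => [||k kj]; [lia|lia|apply: N; lia].
have sj : s <= c j by apply: N; lia.
have gap : 0 < t`_j.+1 - t`_j by apply: partition_gap; lia.
by rewrite cell_sumS; nra.
Qed.

Lemma exists_cell_above c i j s : (i < j <= n)%N ->
  s * (t`_j - t`_i) < cell_sum t c j - cell_sum t c i ->
  exists2 k, (i <= k < j)%N & s < c k.
Proof.
move=> ij H; have [|k kij] := @exists_cell_below (fun k => - c k) i j (- s) ij.
  have E k : cell_sum t (fun k => - c k) k = - cell_sum t c k.
    by rewrite /cell_sum -sumrN; apply: eq_bigr => l _; rewrite mulNr.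
  by rewrite !E; lra.
by rewrite ltrN2; exists k.
Qed.

Lemma cell_mid i : (i < n)%N -> (t`_i + t`_i.+1) / 2 \in `]t`_i, t`_i.+1[.
Proof.
by move=> ni; rewrite in_itv/=; have := @partition_gap i i.+1; rewrite ltnSn ni => /(_ isT); lra.
Qed.

(** The midpoints of the chosen cells, completed by 0 and 1, form a partition; the two extra values
    at the ends destroy no mode. *)
Lemma seq_modes_le_modes g c (s : seq nat) : step_values t n g c ->
  sorted ltn s -> all (fun i => i < n)%N s ->
  ((seq_modes (map c s))%:R%:E <= modes g)%E.
Proof.
move=> gc ss sn.
pose mid i := (t`_i + t`_i.+1) / 2.
pose u := 0 :: rcons (map mid s) 1.
have midP i : (i < n)%N -> t`_i < mid i < t`_i.+1 by move=> /cell_mid; rewrite in_itv.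
have st : sorted <%R (rcons (map mid s) 1).
  have /= -> // : all (fun i => i < n)%N s -> sorted ltn s -> sorted <%R (rcons (map mid s) 1).
  elim: s {u ss sn} => //= i s IH /andP[ni sn] p.
  have {}IH := IH sn (path_sorted p).
  case: s p IH sn => [|j s] /=.
    move=> _ _ _; rewrite andbT; have /andP[_ /lt_le_trans] := midP _ ni; apply.
    exact: (partition_le1 t01 size_t).
  move=> /andP[ij _] -> /andP[jn _]; rewrite andbT.
  have /andP[_ mi] := midP _ ni; have /andP[mj _] := midP _ jn.
  apply: lt_trans mi (le_lt_trans _ mj); apply: (partition_le t01 size_t) => //; exact: ltnW.
have u01 : unit_partition u.
  rewrite /unit_partition /u /= eqxx last_rcons eqxx !andbT.
  rewrite path_min_sorted ?st// all_rcons ltr01/=; apply/allP => _ /mapP[i si ->].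
  have ni := allP sn _ si; have /andP[+ _] := midP _ ni.
  by apply: le_lt_trans; apply: (partition_ge0 t01 size_t); exact: ltnW.
apply: (@le_trans _ _ (modes_on g u)%:R%:E); last by apply: ereal_sup_ubound; exists u.
rewrite lee_fin ler_nat modes_onE /u map_cons map_rcons.
apply: leq_trans (seq_modes_cons _ _); apply: leq_trans (seq_modes_rcons _ _).
rewrite -map_comp; apply: eq_leq; congr seq_modes; apply/eq_in_map => i si /=.
by rewrite (gc i)//; [exact: (allP sn)|apply: cell_mid; exact: (allP sn)].
Qed.

Context (eps : nat -> R) (nxt prv : nat -> nat) (K : knots n eps nxt prv).
Local Notation m a := (\sum_(a <= b < n) peak eps nxt b)%N.

Lemma peaks_from a : alive eps a -> (a < n)%N -> m a = (peak eps nxt a + m (nxt a))%N.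
Proof.
move=> aa an; have [/andP[anx nn] _ _ z] := nxtP K aa an.
rewrite (@big_cat_nat _ _ _ (nxt a))//=; last exact: ltnW.
congr addn; rewrite big_ltn// (eq_big_nat _ _ (F2 := fun=> 0%N)).
  by rewrite big1_eq addn0.
by move=> i ai; rewrite /peak z// eq_sym oner_eq0.
Qed.

(** The inequality is weak on purpose: it must still hold at the radius where a bend vanishes, since
    signatures are computed exactly there. *)
Definition taut F (al : R) := forall b, alive eps b -> (0 < b < n)%N ->
  0 <= eps b * bend (fun j => F j + al * eps j) (prv b) b (nxt b).

(** * Alternating low and high cells of a step function inside the tube *)

Section Zigzag.
Context (F c : nat -> R) (al : R).
Hypotheses (tF : taut F al) (F0 : F 0%N = 0)
  (Fc : forall j, (j <= n)%N -> `|F j - cell_sum t c j| < al).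
Local Notation U := (fun j => F j + al * eps j).
Local Notation sl a := (slope U a (nxt a)).

Lemma slope_nxt a : alive eps a -> (nxt a < n)%N -> (a < n)%N ->
  (eps (nxt a) = 1 -> sl a <= sl (nxt a)) /\ (eps (nxt a) = -1 -> sl (nxt a) <= sl a).
Proof.
move=> aa nn an.
have [/andP[anx _] ab pb _] := nxtP K aa an.
have [/andP[bnx bn] _ _ _] := nxtP K ab nn.
have H : (a < nxt a < nxt (nxt a))%N by rewrite anx bnx.
have ib : (0 < nxt a < n)%N by lia.
have := tF ab ib; rewrite pb => T; split=> e; move: T; rewrite e.
  by rewrite mul1r bend_ge0.
by rewrite mulN1r oppr_ge0 bend_le0.
Qed.

(* At the ends of the block the string lies on the boundary of the tube, on the
   side which makes its slope larger (smaller, in the next lemma) than the mean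
   of [c]. *)
Lemma exists_low_cell a : alive eps a -> (a < n)%N -> eps a != 1 ->
  eps (nxt a) = 1 -> exists2 k, (a <= k < nxt a)%N & c k < sl a.
Proof.
move=> aa an ea eb; have [H _ _ _] := nxtP K aa an; have /andP[anx nn] := H.
apply: exists_cell_below => //.
rewrite /slope divfK; last by rewrite lt0r_neq0// partition_gap.
have : cell_sum t c (nxt a) < U (nxt a).
  by have := Fc nn; rewrite eb ltr_norml; lra.
suff : U a <= cell_sum t c a by lra.
have := Fc (ltnW an); rewrite ltr_norml.
have [e|e|e] := eps_sign K a; rewrite ?e ?eqxx// in ea *; last by lra.
move: aa; rewrite /alive e eqxx orbF => /eqP ->.
by rewrite F0 /cell_sum big_ord0; lra.
Qed.

Lemma exists_high_cell a : alive eps a -> (a < n)%N -> eps a = 1 ->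
  eps (nxt a) = -1 -> exists2 k, (a <= k < nxt a)%N & sl a < c k.
Proof.
move=> aa an ea eb; have [H _ _ _] := nxtP K aa an; have /andP[anx nn] := H.
apply: exists_cell_above => //.
rewrite /slope divfK; last by rewrite lt0r_neq0// partition_gap.
have := Fc nn; have := Fc (ltnW an); rewrite !ltr_norml ea eb; lra.
Qed.

(** Induction from the right end. The selected cells start below the slope of the block if it is not
    entered by an up jump. Otherwise they start above it and then fall, unless no peak remains; that
    first high cell becomes a mode only when a lower cell is put in front of it, which explains the
    shift by one. *)
Lemma zigzag a : alive eps a -> (a < n)%N ->
  (eps a != 1 -> exists i s,
    [/\ sorted ltn (i :: s), all (fun k => a <= k < n)%N (i :: s), c i < sl a
      & (m a <= seq_modes (map c (i :: s)))%N]) /\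
  (eps a = 1 -> m a = 0%N \/ exists i j s,
    [/\ sorted ltn [:: i, j & s], all (fun k => a <= k < n)%N [:: i, j & s],
        sl a < c i, c j < c i
      & (m a <= (seq_modes (map c [:: i, j & s])).+1)%N]).
Proof.
move: {2}(n - a)%N (leqnn (n - a)%N) => d; elim: d a => [|d IH] a na aa an; first lia.
have [/andP[anx nn] ab pb z] := nxtP K aa an.
have ma := peaks_from aa an.
have bn0 : nxt a != 0%N by lia.
have wid s : all (fun k => nxt a <= k < n)%N s -> all (fun k => a <= k < n)%N s.
  by apply: sub_all => k /andP[k1 ->]; rewrite andbT; lia.
(* The last block ends with sign 1, so it is never a peak; a low cell in it is required only when it
   is not entered by an up jump. *)
have [bn|bn] := eqVneq (nxt a) n.
  have ma0 : m a = peak eps nxt a by rewrite ma bn big_geq// addn0.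
  have eb : eps (nxt a) = 1 by rewrite bn (eps_last K).
  have m0 : m a = 0%N.
    by rewrite ma0 /peak eb one_eqN1 andbF.
  split=> ea; last by left.
  have [k kab ck] := exists_low_cell aa an ea eb.
  exists k, [::]; split=> //; last by rewrite m0.
  by rewrite /= andbT; lia.
have {}bn : (nxt a < n)%N by rewrite ltn_neqAle bn.
have [IHlow IHhigh] := IH (nxt a) ltac:(lia) ab bn.
have [s1 s2] := slope_nxt aa bn an.
have eb0 : eps (nxt a) != 0 by move: ab; rewrite /alive (negbTE bn0).
have [eb|eb|eb] := eps_sign K (nxt a); first by rewrite eb eqxx in eb0.
- have pk : peak eps nxt a = false.
    by rewrite /peak eb one_eqN1 andbF.
  rewrite pk add0n in ma; split=> ea.
    have [k /andP[ka kb] ck] := exists_low_cell aa an ea eb.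
    have [mb0|[i [j [s [st al1 hi ji ms]]]]] := IHhigh eb.
      exists k, [::]; split=> //; last by rewrite ma mb0.
      by rewrite /= ka (ltn_trans kb bn).
    exists k, [:: i, j & s]; split=> //.
    + rewrite /sorted path_min_sorted//; apply/allP => x xs.
      by have /andP[+ _] := allP al1 _ xs; exact: leq_trans kb.
    + by apply/andP; split; [by rewrite ka (ltn_trans kb bn)|exact: (wid _ al1)].
    (* The slopes separate the two cells: [c k < sl a <= sl (nxt a) < c i]. *)
    + have ki : c k < c i by have := s1 eb; lra.
      by rewrite ma; apply: leq_trans ms _; rewrite (seq_modes_peak _ ki ji).
  have [mb0|[i [j [s [st al1 hi ji ms]]]]] := IHhigh eb; first by left; rewrite ma.
  right; exists i, j, s; split=> //; [exact: wid|by have := s1 eb; lra|by rewrite ma].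
- have eb1 : eps (nxt a) != 1.
    by rewrite eb eq_sym one_eqN1.
  have [i [s [st al1 lo ms]]] := IHlow eb1.
  split=> ea.
    have pk : peak eps nxt a = false by rewrite /peak (negbTE ea).
    exists i, s; split=> //; [exact: wid|by have := s2 eb; lra|by rewrite ma pk].
  have pk : peak eps nxt a by rewrite /peak ea eb !eqxx.
  have [k /andP[ka kb] ck] := exists_high_cell aa an ea eb.
  right; exists k, i, s; split=> //.
  + rewrite /sorted path_min_sorted//; apply/allP => x xs.
    by have /andP[+ _] := allP al1 _ xs; exact: leq_trans kb.
  + by apply/andP; split; [by rewrite ka (ltn_trans kb bn)|exact: (wid _ al1)].
  + by have := s2 eb; lra.
  + rewrite ma pk add1n ltnS; apply: leq_trans ms _; exact: seq_modes_cons.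
Qed.

Lemma npeaks_le_modes g : step_values t n g c ->
  ((npeaks n eps nxt)%:R%:E <= modes g)%E.
Proof.
move=> gc.
have [+ _] := @zigzag 0%N isT n0.
rewrite (eps_first K) eq_sym oner_eq0 => /(_ isT)[i [s [st al1 _ ms]]].
apply: (@le_trans _ _ (seq_modes (map c (i :: s)))%:R%:E).
  by rewrite lee_fin ler_nat.
by apply: seq_modes_le_modes => //; apply: sub_all al1 => k /andP[].
Qed.

End Zigzag.

End LowerBound.

(** * Bounds on the Kolmogorov signatures *)

Section Tube.
Context {R : realType} (t : seq R) (n : nat).

Definition chord (V : nat -> R) i k j := V i + slope t V i k * (t`_j - t`_i).

(** Testing at partition points suffices, because [F] and the string are both affine in between. *)
Definition in_tube (eps : nat -> R) nxt (F : nat -> R) al :=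
  forall a, alive eps a -> (a < n)%N -> forall j, (a <= j <= nxt a)%N ->
  `|chord (fun j => F j + al * eps j) a (nxt a) j - F j| <= al.

End Tube.

Section SignatureBounds.
Context {R : realType} (t : seq R) (n : nat).
Hypotheses (t01 : unit_partition t) (size_t : size t = n.+1) (n0 : (0 < n)%N).
Context (v : nat -> R) (f : R -> R).
Hypothesis fv : step_values t n f v.
Local Notation F := (cell_sum t v).

Lemma cell_sumB (c : nat -> R) j : cell_sum t (fun i => v i - c i) j = F j - cell_sum t c j.
Proof. by rewrite /cell_sum -sumrB; apply: eq_bigr => i _; rewrite mulrBl. Qed.

Lemma dK_step_le (c : nat -> R) g M : step_values t n g c ->
  dK f g <= M <-> forall j, (j <= n)%N -> `|F j - cell_sum t c j| <= M.
Proof.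
move=> gc; rewrite (@dK_le _ t n t01 size_t f g (fun i => v i - c i))//.
  by split=> H j jn; [rewrite -cell_sumB|rewrite cell_sumB]; exact: H.
by move=> i ni x xi; rewrite (fv ni xi) (gc i ni x xi).
Qed.

Lemma stepX_values g : stepX t g -> exists c, step_values t n g c.
Proof.
move=> [_ H]; exists (fun i => g ((t`_i + t`_i.+1) / 2)) => i ni x xi.
have [|c gc] := H i; first by rewrite size_t.
by rewrite !gc//; exact: cell_mid size_t _ ni.
Qed.

Lemma dK_ge0 g : stepX t g -> 0 <= dK f g.
Proof.
move=> /stepX_values[c gc]; have /(dK_step_le _ gc)/(_ 0%N isT) := lexx (dK f g).
exact: le_trans.
Qed.

Lemma signature_ge M k :
  (forall g, stepX t g -> (modes g <= k%:R%:E)%E -> M <= dK f g) -> M <= signature t f k.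
Proof.
move=> H; apply: lb_le_inf => [|_ [g [gX gk] <-]]; last exact: H.
(* The zero function has no mode, so the set of competitors is nonempty and [inf] is a genuine
   infimum. *)
exists (dK f (step_of t n (fun=> 0))), (step_of t n (fun=> 0)) => //.
split; first exact: stepX_step_of.
apply: ge_ereal_sup => _ [u _ <-]; rewrite lee_fin ler_nat /modes_on.
rewrite (eq_bigr (fun=> 0%N)) ?big1_eq// => i _.
by rewrite /step_of /= maxxx ltxx.
Qed.

Lemma signature_ge0 k : 0 <= signature t f k.
Proof. by apply: signature_ge => g gX _; exact: dK_ge0. Qed.

Lemma signature_le g k : stepX t g -> (modes g <= k%:R%:E)%E -> signature t f k <= dK f g.
Proof.
move=> gX gk; apply: ge_inf; last by exists g.
by exists 0 => _ [h [hX _] <-]; exact: dK_ge0.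
Qed.

Context (eps : nat -> R) (nxt prv : nat -> nat) (K : knots n eps nxt prv) (al : R).
Hypothesis tF : taut t n eps nxt prv F al.
Local Notation U := (fun j => F j + al * eps j).
Local Notation sl a := (slope t U a (nxt a)).

Lemma signature_ge_taut k : (k < npeaks n eps nxt)%N -> al <= signature t f k.
Proof.
move=> km; apply: signature_ge => g gX gk; rewrite leNgt; apply/negP => fg.
have [c gc] := stepX_values gX.
have F0 : F 0%N = 0 by rewrite /cell_sum big_ord0.
have Fc j : (j <= n)%N -> `|F j - cell_sum t c j| < al.
  by move=> jn; apply: le_lt_trans fg; move: j jn; exact/(dK_step_le _ gc).
have := npeaks_le_modes t01 size_t n0 K tF F0 Fc gc.
by move=> /le_trans/(_ gk); rewrite lee_fin ler_nat leqNgt km.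
Qed.

Fixpoint left_knot i :=
  if i is i'.+1 then if alive eps i then i else left_knot i' else 0%N.

Lemma left_knotP i : (i < n)%N ->
  [/\ alive eps (left_knot i), (left_knot i <= i)%N & (i < nxt (left_knot i))%N].
Proof.
elim: i => [_|i IH ni] /=.
  by split=> //; have [/andP[]] := nxtP K (isT : alive eps 0%N) n0.
case: ifPn => [ai|ai].
  by split=> //; have [/andP[]] := nxtP K ai ni.
have [al1 li il] := IH (ltnW ni); split=> //; first exact: leqW.
rewrite ltn_neqAle il andbT; apply: contra ai => /eqP ->.
by have [] := nxtP K al1 (leq_ltn_trans li (ltnW ni)).
Qed.

Lemma left_knot_pred j : (0 < j < n)%N -> alive eps j -> left_knot j.-1 = prv j /\ left_knot j = j.
Proof.
case: j => // j /= jn aj; rewrite aj; split=> //.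
have [al1 lj jl] := left_knotP (ltnW jn).
have [_ _ pb z] := nxtP K al1 (leq_ltn_trans lj (ltnW jn)).
suff E : nxt (left_knot j) = j.+1 by rewrite -pb E.
apply/eqP; rewrite eqn_leq jl andbT leqNgt; apply/negP => jl2.
by move: aj; rewrite /alive z ?eqxx//; lia.
Qed.

Definition block_slope i := sl (left_knot i).

(** Integrating the slope of the string gives back the string; the constant is right because
    [eps 0 = 0] makes the string start at 0. *)
Lemma cell_sum_block_slope i : (i < n)%N ->
  cell_sum t block_slope i.+1 = U (left_knot i) + block_slope i * (t`_i.+1 - t`_(left_knot i)).
Proof.
elim: i => [_|i IH ni].
  by rewrite /cell_sum big_ord1 /= big_ord0 (eps_first K); ring.
rewrite cell_sumS IH 1?ltnW//.
have [ai|ai] := boolP (alive eps i.+1).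
  have [E1 E2] := @left_knot_pred i.+1 ni ai.
  rewrite /block_slope E2; rewrite /= in E1; rewrite E1.
  have [pi pa np] := prvP K ai (ltnW ni); rewrite np.
  rewrite [slope t _ (prv _) _ * _]divfK; first by ring.
  by rewrite lt0r_neq0// (partition_gap t01 size_t)// pi ltnW.
have -> : left_knot i.+1 = left_knot i by rewrite /= (negbTE ai).
have -> : block_slope i.+1 = block_slope i by rewrite /block_slope /= (negbTE ai).
ring.
Qed.

Lemma block_slope_jump j : (0 < j < n)%N ->
  [/\ eps j = 0 -> block_slope j = block_slope j.-1,
      eps j = 1 -> block_slope j.-1 <= block_slope j &
      eps j = -1 -> block_slope j <= block_slope j.-1].
Proof.
move=> jn.
have H : eps j != 0 -> 0 <= eps j * bend t U (prv j) j (nxt j) /\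
    (forall P : R -> R -> Prop, P (sl (prv j)) (sl j) -> P (block_slope j.-1) (block_slope j)).
  move=> ej; have aj := alive_neq0 ej; split; first exact: tF.
  by have [E1 E2] := left_knot_pred jn aj; move=> P; rewrite /block_slope E1 E2.
have G : eps j != 0 -> (prv j < j < nxt j)%N /\ (nxt j <= n)%N /\ nxt (prv j) = j.
  move=> /alive_neq0 aj; have /andP[j0 jn'] := jn.
  have [/andP[-> ->] _ _ _] := nxtP K aj jn'.
  by have [|-> _ ->] := prvP K aj; first by rewrite j0 ltnW.
split=> e.
- case: j jn e {H G} => // j jn e.
  by rewrite /block_slope /= /alive e eqxx.
- have [|b1 b2] := H; first by rewrite e oner_eq0.
  have [|g1 [g2 g3]] := G; first by rewrite e oner_eq0.
  apply: (b2 (fun x y => x <= y)); move: b1.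
  by rewrite e mul1r (bend_ge0 t01 size_t)// g3.
- have [|b1 b2] := H; first by rewrite e oppr_eq0 oner_eq0.
  have [|g1 [g2 g3]] := G; first by rewrite e oppr_eq0 oner_eq0.
  apply: (b2 (fun x y => y <= x)); move: b1.
  by rewrite e mulN1r oppr_ge0 (bend_le0 t01 size_t)// g3.
Qed.

Lemma signature_le_taut k : in_tube t n eps nxt F al -> 0 <= al -> (npeaks n eps nxt <= k)%N ->
  signature t f k <= al.
Proof.
move=> tube al0 mk.
apply: (@le_trans _ _ (dK f (step_of t n block_slope))).
  apply: signature_le; first exact: stepX_step_of.
  apply: (@le_trans _ _ (npeaks n eps nxt)%:R%:E); last by rewrite lee_fin ler_nat.
  apply: (modes_step_of_le K) => // j jn; by have [] := block_slope_jump jn.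
apply/(dK_step_le _ (step_of_values t01 size_t block_slope)) => -[_|j jn].
  by rewrite /cell_sum !big_ord0 subrr normr0.
rewrite cell_sum_block_slope// distrC.
have [al1 lj jl] := left_knotP jn.
by apply: tube => //; [exact: leq_ltn_trans lj jn|rewrite jl leqW].
Qed.

End SignatureBounds.

(** * The flow of taut strings and the removal of a knot *)

Section Flow.
Context {R : realType} (t : seq R) (n : nat).
Hypotheses (t01 : unit_partition t) (size_t : size t = n.+1) (n0 : (0 < n)%N).
Context (F : nat -> R).
Implicit Types (eps U V : nat -> R) (nxt prv : nat -> nat) (al : R).

Local Notation bend := (bend t).

Definition setn {T} (h : nat -> T) i x := fun j => if (j == i)%N then x else h j.

Definition inner_knot eps b := alive eps b && (0 < b < n)%N.

(** [flow_strict] keeps the denominator of [rate] nonzero at every knot whose bend actually moves,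
    which tautness does not provide at radius 0. The last three fields are the link conventions
    under which [rate] evaluates to 0 at both ends and at deleted knots. *)
Record flow eps nxt prv al : Prop := Flow {
  flow_knots : knots n eps nxt prv;
  flow_ge0 : 0 <= al;
  flow_taut : taut t n eps nxt prv F al;
  flow_tube : in_tube t n eps nxt F al;
  flow_strict : forall b, inner_knot eps b ->
    bend eps (prv b) b (nxt b) = 0 \/ 0 < eps b * bend F (prv b) b (nxt b);
  prv_first : prv 0%N = 0%N;
  nxt_last : nxt n = n;
  flow_dead : forall b, (b <= n)%N -> ~~ alive eps b -> nxt b = 0%N /\ prv b = 0%N
}.

(* The inverse of the time at which the bend at [b] vanishes, and 0 if it never does. *)
Definition rate eps nxt prv b :=
  - bend eps (prv b) b (nxt b) / bend F (prv b) b (nxt b).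

Lemma bendD U V al i j k :
  bend (fun l => U l + al * V l) i j k = bend U i j k + al * bend V i j k.
Proof. by rewrite /bend; ring. Qed.

Lemma convex_bound (p q x : R) : -1 <= p <= 1 -> -1 <= q <= 1 -> 0 <= x -> x <= 1 ->
  -1 <= p + (q - p) * x <= 1.
Proof.
move=> /andP[p1 p2] /andP[q1 q2] x0 x1.
have E : p + (q - p) * x = (1 - x) * p + x * q by ring.
have y0 : 0 <= 1 - x by lra.
have A := ler_wpM2l y0 p1; have B := ler_wpM2l y0 p2.
have C := ler_wpM2l x0 q1; have D := ler_wpM2l x0 q2.
by rewrite E; apply/andP; split; lra.
Qed.

Lemma sum_nat_at k i x : (i < k)%N -> (\sum_(0 <= j < k) (if j == i then x else 0))%N = x.
Proof.
move=> ik; rewrite (bigD1_seq i) ?iota_uniq ?mem_index_iota//= eqxx big1 ?addn0// => j /negbTE ->.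
by [].
Qed.

Lemma sum_update2 k i j (h h' : nat -> nat) : (i < k)%N -> (j < k)%N -> i != j ->
  (forall l, (0 <= l < k)%N -> l != i -> l != j -> h' l = h l) ->
  (\sum_(0 <= l < k) h' l + (h i + h j) = \sum_(0 <= l < k) h l + (h' i + h' j))%N.
Proof.
move=> ik jk ij H.
rewrite -{1}(sum_nat_at (h i) ik) -{1}(sum_nat_at (h j) jk).
rewrite -(sum_nat_at (h' i) ik) -(sum_nat_at (h' j) jk) -!big_split/=.
apply: eq_big_nat => l lk; have [->|li] := eqVneq l i; first by rewrite (negbTE ij); lia.
by have [->|lj] := eqVneq l j; [lia|rewrite H].
Qed.

Lemma signed_bend_ge0 e U i j k : (i < j < k)%N -> (k <= n)%N ->
  (0 <= e * bend U i j k) = (0 <= e * (slope t U j k - slope t U i j)).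
Proof.
move=> /[dup] H /andP[ij jk] kn; rewrite (bendE t01 size_t)// mulrA pmulr_lge0//.
by rewrite mulr_gt0// (partition_gap t01 size_t)// ?ij ?jk//; lia.
Qed.

Lemma slope_straight U i j k : (i < j < k)%N -> (k <= n)%N -> bend U i j k = 0 ->
  slope t U i k = slope t U i j /\ slope t U j k = slope t U i j.
Proof.
move=> /andP[ij jk] kn; rewrite /bend /slope.
have : 0 < t`_j - t`_i by rewrite (partition_gap t01 size_t)// ij; lia.
have : 0 < t`_k - t`_j by rewrite (partition_gap t01 size_t)// jk.
have -> : t`_k - t`_i = (t`_k - t`_j) + (t`_j - t`_i) by ring.
have -> : U k - U i = (U k - U j) + (U j - U i) by ring.
move: (t`_k - t`_j) (t`_j - t`_i) (U k - U j) (U j - U i) => q p y x q0 p0 E.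
have yp : y * p = x * q by lra.
by split; apply/eqP; rewrite eqr_div ?lt0r_neq0 ?addr_gt0//; apply/eqP; lra.
Qed.

Section Step.
Context (eps : nat -> R) (nxt prv : nat -> nat).

Lemma eps_cases (K : knots n eps nxt prv) b : eps b != 0 -> eps b = 1 \/ eps b = -1.
Proof. by have [->|->|->] := eps_sign K b; rewrite ?eqxx; [|left|right]. Qed.

Lemma knot_neighbours (K : knots n eps nxt prv) b : inner_knot eps b ->
  [/\ eps b != 0, (prv b < b < nxt b)%N, (nxt b <= n)%N & alive eps (prv b) && alive eps (nxt b)].
Proof.
case/andP=> ab /andP[b0 bn].
have [/andP[-> ->] -> _ _] := nxtP K ab bn.
have [|-> -> _] := prvP K ab; first by rewrite b0 ltnW.
by split=> //; move: ab; rewrite /alive; case: eqP b0 => // ->.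
Qed.

(** At an up knot [eps] takes its maximum 1, at a down knot its minimum -1, so [eps] itself bends
    against the announced sign. This is why growing [al] can only flatten the kinks. *)
Lemma eps_bend_le0 (K : knots n eps nxt prv) b : inner_knot eps b ->
  eps b * bend eps (prv b) b (nxt b) <= 0.
Proof.
move=> ib; have [eb /andP[pb bn] nn _] := knot_neighbours K ib.
have g1 : 0 < t`_b - t`_(prv b) by rewrite (partition_gap t01 size_t)// pb; lia.
have g2 : 0 < t`_(nxt b) - t`_b by rewrite (partition_gap t01 size_t)// bn.
have h1 : -1 <= eps (prv b) <= 1 by have [->|->|->] := eps_sign K (prv b); lra.
have h2 : -1 <= eps (nxt b) <= 1 by have [->|->|->] := eps_sign K (nxt b); lra.
have h3 : eps b = 1 \/ eps b = -1 by exact: eps_cases.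
rewrite /bend; move: (eps (prv b)) (eps (nxt b)) h1 h2 => x y /andP[x1 x2] /andP[y1 y2].
by case: h3 => ->; nra.
Qed.

(** If the signed bend strictly decreases with the radius and is still nonnegative at [al > 0], it
    was positive at radius 0. This restores [flow_strict] after each deletion. *)
Lemma strict_of_taut (K : knots n eps nxt prv) al b : 0 < al ->
  taut t n eps nxt prv F al -> inner_knot eps b ->
  bend eps (prv b) b (nxt b) = 0 \/ 0 < eps b * bend F (prv b) b (nxt b).
Proof.
move=> al0 tF ib; have [|H] := eqVneq (bend eps (prv b) b (nxt b)) 0; first by left.
right; have [eb _ _ _] := knot_neighbours K ib.
have := eps_bend_le0 K ib; have /andP[ab bn] := ib; have := tF b ab bn.
rewrite bendD mulrDr mulrCA.
have : eps b * bend eps (prv b) b (nxt b) != 0 by rewrite mulf_neq0.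
by rewrite neq_lt => /orP[]; nra.
Qed.

(** At a fixed abscissa the string moves by [al' - al] times an interpolated value of [eps], which
    lies between -1 and 1; the walls of the tube move at least as fast. *)
Lemma in_tube_mono (K : knots n eps nxt prv) al al' : al <= al' ->
  in_tube t n eps nxt F al -> in_tube t n eps nxt F al'.
Proof.
move=> aal H a aa an j aj; have := H a aa an j aj.
have [/andP[anx nn] _ _ _] := nxtP K aa an.
pose x := (t`_j - t`_a) / (t`_(nxt a) - t`_a).
have gp : 0 < t`_(nxt a) - t`_a by rewrite (partition_gap t01 size_t)// anx.
have [x0 x1] : 0 <= x /\ x <= 1.
  have /andP[j1 j2] := aj.
  have ta : t`_a <= t`_j by apply: (partition_le t01 size_t) => //; lia.
  have tb : t`_j <= t`_(nxt a) by apply: (partition_le t01 size_t).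
  by rewrite /x ler_pdivrMr// ler_pdivlMr//; split; lra.
have E V : chord t V a (nxt a) j = V a + (V (nxt a) - V a) * x.
  by rewrite /chord /slope /x; field; rewrite lt0r_neq0.
rewrite !E.
have h1 : -1 <= eps a <= 1 by have [->|->|->] := eps_sign K a; lra.
have h2 : -1 <= eps (nxt a) <= 1 by have [->|->|->] := eps_sign K (nxt a); lra.
have : -1 <= eps a + (eps (nxt a) - eps a) * x <= 1.
  exact: convex_bound.
set z := _ + _ * x => /andP[z1 z2].
have E2 c : F a + c * eps a + (F (nxt a) + c * eps (nxt a) - (F a + c * eps a)) * x
    = F a + (F (nxt a) - F a) * x + c * z by rewrite /z; ring.
have d0 : 0 <= al' - al by rewrite subr_ge0.
have P := ler_wpM2l d0 z1; have Q := ler_wpM2l d0 z2.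
by rewrite !E2 !ler_norml => /andP[A1 A2]; apply/andP; split; lra.
Qed.

End Step.

Section State.
Context (eps : nat -> R) (nxt prv : nat -> nat).
Context (al : R) (W : flow eps nxt prv al).
Let K := flow_knots W.
Local Notation r := (rate eps nxt prv).

(** At an end of the interval two of the three indices coincide, and at a deleted knot all three
    signs are 0, so the numerator vanishes. The program can therefore evaluate one formula at every
    index. *)
Lemma rate_eq0 b : (b <= n)%N -> ~~ inner_knot eps b -> r b = 0.
Proof.
move=> bn; rewrite /rate /bend /inner_knot negb_and => /orP[ab|].
  have [-> ->] := flow_dead W bn ab.
  have -> : eps b = 0 by move: ab; rewrite /alive negb_or negbK => /andP[_ /eqP].
  by rewrite (eps_first K); ring.
rewrite negb_and -!leqNgt leqn0 => /orP[/eqP ->|nb].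
  by rewrite (prv_first W); ring.
have -> : b = n by lia.
by rewrite (nxt_last W); ring.
Qed.

Lemma rateE b : inner_knot eps b ->
  r b = - (eps b * bend eps (prv b) b (nxt b)) / (eps b * bend F (prv b) b (nxt b)).
Proof.
move=> /(knot_neighbours K)[eb _ _ _]; rewrite /rate.
by case: (eps_cases K eb) => ->; rewrite ?mul1r// !mulN1r opprK invrN mulrN mulNr.
Qed.

(** The left knot of a peak has sign 1 and its successor has sign -1, so its signed bend strictly
    decreases. Hence a next event exists as long as peaks remain. *)
Lemma exists_rate_gt0 : (0 < npeaks n eps nxt)%N -> exists2 b, (b <= n)%N & 0 < r b.
Proof.
move=> np.
have [p pn /andP[/eqP ep /eqP eq]] : exists2 p, (p < n)%N & peak eps nxt p.
  apply: contrapT => /forall2NP N; move: np; rewrite /npeaks big_nat.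
  by rewrite big1// => i /andP[_ ni]; case: (N i) => // /negP/negbTE ->.
have ip : inner_knot eps p.
  rewrite /inner_knot alive_neq0 ?ep ?oner_eq0// pn andbT lt0n.
  by apply/eqP => p0; move: ep; rewrite p0 (eps_first K) => /eqP; rewrite eq_sym oner_eq0.
exists p; first exact: ltnW.
have [ep0 /andP[pb bn] nn _] := knot_neighbours K ip.
have g1 : 0 < t`_p - t`_(prv p) by rewrite (partition_gap t01 size_t)// pb; lia.
have g2 : 0 < t`_(nxt p) - t`_p by rewrite (partition_gap t01 size_t)// bn.
have h1 : -1 <= eps (prv p) <= 1 by have [->|->|->] := eps_sign K (prv p); lra.
have neg : eps p * bend eps (prv p) p (nxt p) < 0.
  rewrite /bend ep eq; move: (eps (prv p)) h1 => x /andP[x1 x2]; nra.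
rewrite rateE// divr_gt0// ?oppr_gt0//.
by case: (flow_strict W ip) => // z; move: neg; rewrite z mulr0 ltxx.
Qed.

(** * The next event and the removal of its knot *)

Section Event.
Context (b : nat).
Hypotheses (bn : (b <= n)%N) (rb : 0 < r b)
  (rmax : forall j, (j <= n)%N -> r j <= r b).
Local Notation al' := (r b)^-1.

Lemma event_inner_knot : inner_knot eps b.
Proof. by apply: contraT => /rate_eq0 E; move: rb; rewrite E// ltxx. Qed.

Lemma event_bendF : 0 < eps b * bend F (prv b) b (nxt b).
Proof.
case: (flow_strict W event_inner_knot) => // z.
by move: rb; rewrite /rate z oppr0 mul0r ltxx.
Qed.

Lemma event_bend : bend (fun j => F j + al' * eps j) (prv b) b (nxt b) = 0.
Proof.
have P := event_bendF; have /lt0r_neq0 := rb; rewrite bendD /rate.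
have : bend F (prv b) b (nxt b) != 0.
  by apply: contraTneq P => ->; rewrite mulr0 ltxx.
move: (bend F _ _ _) (bend eps _ _ _) => x y x0.
by rewrite mulf_eq0 oppr_eq0 invr_eq0 negb_or => /andP[y0 _]; field; rewrite x0 y0.
Qed.

(** Tautness at [b] for the current radius says that [al * r b <= 1]. *)
Lemma event_ge : al <= al'.
Proof.
have P := event_bendF; have ib := event_inner_knot.
have := flow_taut W; have /andP[ab bb] := ib => /(_ b ab bb).
rewrite bendD mulrDr mulrCA => T.
rewrite -[al']mul1r ler_pdivlMr// rateE// mulrA ler_pdivrMr//; lra.
Qed.

(** Wherever the bend moves, tautness at radius [x] amounts to [x * r j <= 1], so it holds for all
    knots at the inverse of the largest rate. *)
Lemma event_taut : taut t n eps nxt prv F al'.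
Proof.
move=> j aj jn; have ij : inner_knot eps j by rewrite /inner_knot aj.
have T := flow_taut W aj jn; have Q := eps_bend_le0 K ij; move: T.
have E x : eps j * bend (fun l => F l + x * eps l) (prv j) j (nxt j)
    = eps j * bend F (prv j) j (nxt j) + x * (eps j * bend eps (prv j) j (nxt j)).
  by rewrite bendD mulrDr mulrCA.
rewrite !E.
case: (flow_strict W ij) => [->|P]; first by rewrite !mulr0.
move=> _; have := rmax (_ : (j <= n)%N); rewrite rateE// ler_pdivrMr// => /(_ _) H.
have {}H : - (eps j * bend eps (prv j) j (nxt j)) <= r b * (eps j * bend F (prv j) j (nxt j)).
  by apply: H; lia.
have := ler_wpM2l (_ : 0 <= al') H; rewrite invr_ge0 ltW// => /(_ isT).
by rewrite mulKf ?lt0r_neq0//; lra.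
Qed.

Local Notation a := (prv b).
Local Notation c := (nxt b).
Local Notation eps' := (setn eps b 0).
Local Notation nxt' := (setn (setn nxt b 0%N) a c).
Local Notation prv' := (setn (setn prv b 0%N) c a).

Lemma event_order : [/\ (0 < b < n)%N, (a < b < c)%N, (c <= n)%N, alive eps a & alive eps c].
Proof.
have ib := event_inner_knot; have [_ -> -> /andP[-> ->]] := knot_neighbours K ib.
by have /andP[_ ->] := ib.
Qed.

Lemma event_links : nxt a = b /\ prv c = b.
Proof.
have ib := event_inner_knot; have /andP[ab /andP[b0 bb]] := ib.
have [_ _ -> _] := nxtP K ab bb.
by have [|_ _ ->] := prvP K ab; first by rewrite b0 ltnW.
Qed.

Lemma alive_delete j : alive eps' j = alive eps j && (j != b)%N.
Proof.
have [/andP[b0 _] _ _ _ _] := event_order.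
rewrite /alive /setn; case: (eqVneq j b) => [->|_]; last by rewrite andbT.
by rewrite eqxx orbF andbF; apply/negbTE; rewrite -lt0n.
Qed.

Lemma knots_delete : knots n eps' nxt' prv'.
Proof.
have [/andP[b0 b1] /andP[ab bc] cn aa ac] := event_order.
have [na pc] := event_links.
have bal : alive eps b by have /andP[] := event_inner_knot.
have anb : (a == b)%N = false by apply/negbTE; lia.
have cnb : (c == b)%N = false by apply/negbTE; lia.
have anc : (a == c)%N = false by apply/negbTE; lia.
have cna : (c == a)%N = false by apply/negbTE; lia.
split; first split.
- move=> j; rewrite alive_delete => /andP[aj jb] jn.
  have [jn1 anj pj z] := nxtP K aj jn.
  rewrite alive_delete /setn (negbTE jb); case: (eqVneq j a) => [ja|ja].
    rewrite ja cnb eqxx ac (ltn_trans ab bc) cn; split=> // i /andP[ai ic].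
    case: (ltngtP i b) => // ib.
      by have [_ _ _ ->] := nxtP K aa (ltn_trans ab b1); rewrite // na ai ib.
    by have [_ _ _ ->] := nxtP K bal b1; rewrite // ib ic.
  have E1 : (nxt j == c)%N = false.
    by apply/negbTE/eqP => E; move: pj; rewrite E pc => /eqP; rewrite eq_sym (negbTE jb).
  have E2 : (nxt j == b)%N = false.
    by apply/negbTE/eqP => E; move: pj; rewrite E => /eqP; rewrite eq_sym (negbTE ja).
  by rewrite E1 E2 anj; split=> // i ij; case: eqP => // _; exact: z.
- move=> j; rewrite alive_delete => /andP[aj jb] jn.
  have [pj apj npj] := prvP K aj jn.
  rewrite alive_delete /setn (negbTE jb); case: (eqVneq j c) => [jc|jc].
    by rewrite jc anb eqxx aa (ltn_trans ab bc).
  have E1 : (prv j == a)%N = false.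
    by apply/negbTE/eqP => E; move: npj; rewrite E na => /eqP; rewrite eq_sym (negbTE jb).
  have E2 : (prv j == b)%N = false.
    by apply/negbTE/eqP => E; move: npj; rewrite E => /eqP; rewrite eq_sym (negbTE jc).
  by rewrite E1 E2 apj.
- by rewrite /setn (eps_first K); case: eqP.
- by rewrite /setn (eps_last K) ifF//; apply/negbTE; lia.
- by move=> j; rewrite /setn; case: eqP => _; [constructor 1|exact: (eps_sign K)].
Qed.

(** Peaks are indexed by their left knots, so only the summands at [a] and [b] change. The old
    summands are added on the left to avoid truncated subtraction. *)
Lemma npeaks_delete :
  (npeaks n eps' nxt' + (peak eps nxt a + peak eps nxt b))%N =
  (npeaks n eps nxt + ((eps a == 1)%R && (eps c == -1)%R))%N.
Proof.
have [/andP[b0 b1] /andP[ab bc] cn aa ac] := event_order.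
have [na pc] := event_links.
have anb : (a == b)%N = false by apply/negbTE; lia.
have cnb : (c == b)%N = false by apply/negbTE; lia.
have E j : (0 <= j < n)%N -> j != a -> j != b ->
    peak eps' nxt' j = peak eps nxt j :> nat.
  move=> /= jn ja jb; rewrite /peak /setn (negbTE ja) (negbTE jb).
  have [e|ej] := eqVneq (eps j) 0; first by rewrite e eq_sym oner_eq0.
  rewrite ifF//; apply/negbTE/eqP => nj.
  by have [_ _ pj _] := nxtP K (alive_neq0 ej) jn; move: ja; rewrite -pj nj eqxx.
have -> : ((eps a == 1) && (eps c == -1)) = peak eps' nxt' a.
  by rewrite /peak /setn eqxx anb cnb.
have pb : peak eps' nxt' b = false.
  by rewrite /peak /setn eqxx eq_sym oner_eq0.
have := @sum_update2 n a b (fun j => peak eps nxt j) (fun j => peak eps' nxt' j).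
by rewrite pb addn0; apply=> //; [lia|rewrite anb].
Qed.

Local Notation U := (fun j => F j + al' * eps j).
Local Notation U' := (fun j => F j + al' * eps' j).

Lemma event_slope : slope t U a c = slope t U a b /\ slope t U b c = slope t U a b.
Proof.
have [_ abc cn _ _] := event_order.
exact: slope_straight abc cn event_bend.
Qed.

(** As the bend at [b] is 0, the merged block has the common slope of its two halves. The neighbours
    of [b] see the same slopes as before, and the modified sign at [b] enters no remaining bend. *)
Lemma taut_delete : taut t n eps' nxt' prv' F al'.
Proof.
have [/andP[b0 b1] /andP[ab bc] cn aa ac] := event_order.
have [na pc] := event_links; have [s1 s2] := event_slope.
have Ub i j k : i != b -> j != b -> k != b -> bend U' i j k = bend U i j k.
  by rewrite /bend /setn => /negbTE -> /negbTE -> /negbTE ->.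
move=> j; rewrite alive_delete => /andP[aj jb] jn.
have T := event_taut aj jn.
have ij : inner_knot eps j by rewrite /inner_knot aj.
have [_ /andP[pj nj] nn _] := knot_neighbours K ij.
have [_ _ npj] : [/\ (prv j < j)%N, alive eps (prv j) & nxt (prv j) = j].
  by apply: (prvP K aj); lia.
have [_ _ pnj _] := nxtP K aj (proj2 (andP jn)).
have eE : eps' j = eps j by rewrite /setn (negbTE jb).
rewrite eE; have [ja|ja] := eqVneq j a.
  subst j; have -> : prv' a = prv a by rewrite /setn !ifF//; apply/negbTE; lia.
  have -> : nxt' a = c by rewrite /setn eqxx.
  rewrite Ub//; [|by lia|by lia].
  rewrite na in T nj nn; move: T.
  by rewrite !signed_bend_ge0 ?s1//; lia.
have -> : nxt' j = nxt j by rewrite /setn (negbTE ja) (negbTE jb).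
have nb : nxt j != b by apply/eqP => E; move: ja; rewrite -pnj E eqxx.
have [jc|jc] := eqVneq j c.
  subst j; have -> : prv' c = a by rewrite /setn eqxx.
  rewrite Ub//; last by lia.
  rewrite pc in T pj; move: T.
  by rewrite !signed_bend_ge0 ?s1 ?s2//; lia.
have -> : prv' j = prv j by rewrite /setn (negbTE jc) (negbTE jb).
rewrite Ub//; apply/eqP => E; move: jc; rewrite -npj E eqxx //.
Qed.

Lemma tube_delete : in_tube t n eps' nxt' F al'.
Proof.
have [/andP[b0 b1] /andP[ab bc] cn aa ac] := event_order.
have [na pc] := event_links; have [s1 s2] := event_slope.
have tb := in_tube_mono K event_ge (flow_tube W).
have Ub i k j : i != b -> k != b -> chord t U' i k j = chord t U i k j.
  by rewrite /chord /slope /setn => /negbTE -> /negbTE ->.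
move=> i; rewrite alive_delete => /andP[ai ib] inn j.
have [ia|ia] := eqVneq i a.
  subst i; have -> : nxt' a = c by rewrite /setn eqxx.
  move=> /andP[aj jc]; rewrite Ub//; last by lia.
  have [jb|bj] := leqP j b.
    have := tb a aa inn j; rewrite na aj jb => /(_ isT).
    by rewrite /chord s1.
  have bal : alive eps b by have /andP[] := event_inner_knot.
  have := tb b bal b1 j; rewrite (ltnW bj) jc => /(_ isT).
  rewrite /chord s1 s2.
  have -> : F b + al' * eps b = F a + al' * eps a + slope t U a b * (t`_b - t`_a).
    rewrite /slope divfK; first by ring.
    by rewrite lt0r_neq0// (partition_gap t01 size_t)// ab ltnW.
  set s := slope _ _ _ _; rewrite (_ : _ + _ + s * _ + s * _ = F a + al' * eps a + s * (t`_j - t`_a))//; ring.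
have -> : nxt' i = nxt i by rewrite /setn (negbTE ia) (negbTE ib).
have [_ _ pni _] := nxtP K ai inn.
move=> ij; rewrite Ub//; first exact: tb.
by apply/eqP => E; move: ia; rewrite -pni E eqxx.
Qed.

Lemma flow_delete : flow eps' nxt' prv' al'.
Proof.
have [/andP[b0 b1] /andP[ab bc] cn aa ac] := event_order.
have al0 : 0 < al' by rewrite invr_gt0.
split.
- exact: knots_delete.
- exact: ltW.
- exact: taut_delete.
- exact: tube_delete.
- by move=> j; exact: (strict_of_taut knots_delete al0 taut_delete).
- by rewrite /setn !ifF ?(prv_first W)//; apply/negbTE; lia.
- by rewrite /setn !ifF ?(nxt_last W)//; apply/negbTE; lia.
- move=> j jn; rewrite alive_delete negb_and negbK => /orP[dj|/eqP ->].
    have [n1 p1] := flow_dead W jn dj.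
    have ja : j != a by apply: contraNneq dj => ->.
    have jc : j != c by apply: contraNneq dj => ->.
    by rewrite /setn (negbTE ja) (negbTE jc) n1 p1 !if_same.
  by rewrite /setn eqxx !ifF//; apply/negbTE; lia.
Qed.

End Event.
End State.
End Flow.

(** * The string at radius 0 *)

Section InitialFlow.
Context {R : realType} (t : seq R) (n : nat).
Hypotheses (t01 : unit_partition t) (size_t : size t = n.+1) (n0 : (0 < n)%N).
Context (v eps : nat -> R) (nxt prv : nat -> nat).
Hypotheses (K : knots n eps nxt prv)
  (jump : forall j, (0 < j < n)%N ->
    [/\ eps j = 0 -> v j = v j.-1, eps j = 1 -> v j.-1 < v j & eps j = -1 -> v j < v j.-1]).
Local Notation F := (cell_sum t v).

Lemma block_cst a j : alive eps a -> (a < n)%N -> (a <= j < nxt a)%N -> v j = v a.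
Proof.
move=> aa an; have [/andP[anx nn] _ _ z] := nxtP K aa an.
elim: j => [|j IH]; first by rewrite leqn0 => /andP[/eqP ->].
move=> /andP[]; rewrite leq_eqVlt => /predU1P[-> //|aj] jn.
have jn1 : (0 < j.+1 < n)%N by lia.
have [e0 _ _] := jump jn1; rewrite e0; first by apply: IH; lia.
by apply: z; lia.
Qed.

Lemma cell_sum_block a j : alive eps a -> (a < n)%N -> (a <= j <= nxt a)%N ->
  F j = F a + v a * (t`_j - t`_a).
Proof.
move=> aa an; elim: j => [|j IH].
  by rewrite leqn0 => /andP[/eqP -> _]; rewrite subrr mulr0 addr0.
move=> /andP[]; rewrite leq_eqVlt => /predU1P[-> _|aj jn].
  by rewrite subrr mulr0 addr0.
rewrite cell_sumS IH; last by lia.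
by rewrite (@block_cst a j)//; [ring|lia].
Qed.

Lemma slope_block a : alive eps a -> (a < n)%N -> slope t F a (nxt a) = v a.
Proof.
move=> aa an; have [/andP[anx nn] _ _ _] := nxtP K aa an.
rewrite /slope (@cell_sum_block a (nxt a))//; last by rewrite leqnn ltnW.
rewrite addrAC subrr add0r mulfK// lt0r_neq0// (partition_gap t01 size_t)//.
by rewrite anx.
Qed.

(** The primitive has slope [v a] on the block that starts at [a], so its bend at a knot has the
    sign of the jump of [v] there, which is strict by the choice of the knots. *)
Lemma initial_strict b : inner_knot n eps b -> 0 < eps b * bend t F (prv b) b (nxt b).
Proof.
move=> ib; have [eb pbn nn _] := knot_neighbours K ib.
have /andP[ab bn] := ib; have /andP[b0 b1] := bn; have /andP[pb nb] := pbn.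
have [pbb pa np] : [/\ (prv b < b)%N, alive eps (prv b) & nxt (prv b) = b].
  by apply: (prvP K ab); rewrite b0 ltnW.
rewrite (bendE t01 size_t)// slope_block//.
have -> : slope t F (prv b) b = v b.-1.
  rewrite -{2}np slope_block//; last exact: ltn_trans b1.
  by rewrite (@block_cst (prv b) b.-1)//; [exact: ltn_trans b1|rewrite np; lia].
have g : 0 < (t`_b - t`_(prv b)) * (t`_(nxt b) - t`_b).
  by rewrite mulr_gt0// (partition_gap t01 size_t)// ?pb ?nb//; lia.
rewrite mulrA pmulr_lgt0//.
have [_ j1 j2] := jump bn.
by case: (eps_cases K eb) => e; rewrite e; [have := j1 e|have := j2 e]; lra.
Qed.

Lemma initial_flow : prv 0%N = 0%N -> nxt n = n ->
  (forall b, (b <= n)%N -> ~~ alive eps b -> nxt b = 0%N /\ prv b = 0%N) ->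
  flow t n F eps nxt prv 0.
Proof.
move=> p0 nn dead; split=> //.
- move=> b ab bn; rewrite bendD mul0r addr0 ltW//.
  by apply: initial_strict; rewrite /inner_knot ab.
- move=> a aa an j aj; have [/andP[anx _] _ _ _] := nxtP K aa an.
  rewrite /chord !mul0r addr0.
  have -> : slope t (fun j => F j + 0 * eps j) a (nxt a) = slope t F a (nxt a).
    by rewrite /slope !mul0r !addr0.
  by rewrite slope_block// (@cell_sum_block a j)// subrr normr0.
- by move=> b ib; right; exact: initial_strict.
Qed.

End InitialFlow.

(** * Effect of a deletion on the rates and on the number of knots *)

Section RateUpdate.
Context {R : realType} (t : seq R) (n : nat).
Hypotheses (t01 : unit_partition t) (size_t : size t = n.+1) (n0 : (0 < n)%N).
Context (F eps : nat -> R) (nxt prv : nat -> nat) (al : R).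
Hypothesis W : flow t n F eps nxt prv al.
Let K := flow_knots W.

Lemma flow_link_le j : (j <= n)%N -> (nxt j <= n)%N /\ (prv j <= n)%N.
Proof.
move=> jn; have [aj|dj] := boolP (alive eps j); last by have [-> ->] := flow_dead W jn dj.
split.
  have [->|jn'] := eqVneq j n; first by rewrite (nxt_last W).
  by have [|/andP[]] := nxtP K aj; first by rewrite ltn_neqAle jn' jn.
have [->|j0] := posnP j; first by rewrite (prv_first W).
have [|pj _ _] := prvP K aj; first by rewrite j0.
exact: leq_trans (ltnW pj) jn.
Qed.

(** The variant of the deletion loop, which bounds the number of deletions by [n]. *)
Definition nalive (e : nat -> R) := (\sum_(0 <= j < n) (e j != 0)%R)%N.

Context (b : nat).
Hypotheses (bn : (b <= n)%N) (rb : 0 < rate t F eps nxt prv b).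
Local Notation a := (prv b).
Local Notation c := (nxt b).
Local Notation eps' := (setn eps b 0).
Local Notation nxt' := (setn (setn nxt b 0%N) a c).
Local Notation prv' := (setn (setn prv b 0%N) c a).

(** A rate reads signs only at [prv j], [j] and [nxt j]. None of these is [b] when [j] is neither
    [b] nor one of its neighbours; for a deleted [j] the links are 0, and [b] is positive. *)
Lemma rate_delete j : (j <= n)%N -> j != b -> j != a -> j != c ->
  rate t F eps' nxt' prv' j = rate t F eps nxt prv j.
Proof.
move=> jn jb ja jc.
have [/andP[b0 b1] /andP[ab bc] cn aa ac] := event_order t01 size_t n0 W bn rb.
have nE : nxt' j = nxt j by rewrite /setn (negbTE ja) (negbTE jb).
have pE : prv' j = prv j by rewrite /setn (negbTE jc) (negbTE jb).
have nb : nxt j != b.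
  have [aj|dj] := boolP (alive eps j); last first.
    by have [-> _] := flow_dead W jn dj; rewrite eq_sym -lt0n.
  have [->|jn'] := eqVneq j n; first by rewrite (nxt_last W) gtn_eqF.
  have [|_ _ pj _] := nxtP K aj; first by rewrite ltn_neqAle jn' jn.
  by apply: contra ja => /eqP E; rewrite -pj E.
have pb : prv j != b.
  have [aj|dj] := boolP (alive eps j); last first.
    by have [_ ->] := flow_dead W jn dj; rewrite eq_sym -lt0n.
  have [->|j0] := posnP j; first by rewrite (prv_first W) eq_sym -lt0n.
  have [|_ _ nj] := prvP K aj; first by rewrite j0.
  by apply: contra jc => /eqP E; rewrite -nj E.
rewrite /rate nE pE /bend /setn.
by rewrite (negbTE jb) (negbTE nb) (negbTE pb).
Qed.

Lemma nalive_delete : (nalive eps' < nalive eps)%N.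
Proof.
have [/andP[b0 b1] _ _ _ _] := event_order t01 size_t n0 W bn rb.
have [eb _ _ _] := knot_neighbours K (event_inner_knot t01 size_t n0 W bn rb).
have U : uniq (index_iota 0 n) by exact: iota_uniq.
have B1 : b \in index_iota 0 n by rewrite mem_index_iota.
rewrite /nalive (bigD1_seq b B1 U)/= [X in (_ < X)%N](bigD1_seq b B1 U)/=.
rewrite eb /setn eqxx eqxx add0n add1n ltnS; apply: leq_sum => j /negbTE ->.
by [].
Qed.

Lemma nalive_le e : (nalive e <= n)%N.
Proof.
apply: (@leq_trans (\sum_(0 <= j < n) 1)%N); first by apply: leq_sum => j _; exact: leq_b1.
by rewrite sum_nat_const_nat subn0 muln1.
Qed.

End RateUpdate.

(** * The program *)

Section Runs.
Context {R : realType}.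
Implicit Types (s : memory R) (p q : cmd) (b : bexp).

Definition runs p s (T : nat) (Q : memory R -> Prop) :=
  exists c s', [/\ exec p s c s', (c <= T)%N & Q s'].

Lemma runs_le p s T T' (Q Q' : memory R -> Prop) : (T <= T')%N ->
  (forall s', Q s' -> Q' s') -> runs p s T Q -> runs p s T' Q'.
Proof.
move=> TT QQ [c [s' [e cT Qs]]]; exists c, s'; split=> //; last exact: QQ.
exact: leq_trans TT.
Qed.

Lemma runs_seq p q s T1 T2 (P Q : memory R -> Prop) : runs p s T1 P ->
  (forall s', P s' -> runs q s' T2 Q) -> runs (Seq p q) s (T1 + T2) Q.
Proof.
move=> [c [s1 [e1 c1 P1]]] /(_ _ P1)[d [s2 [e2 d2 Q2]]].
by exists (c + d)%N, s2; split=> //; [exact: ExecSeq e1 e2|exact: leq_add].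
Qed.

(** The index of the invariant is a variant bounding the remaining iterations; it may drop by more
    than one. The last summand of the cost pays for the failing test. *)
Lemma runs_while b p Tb (I : nat -> memory R -> Prop) k s : I k s ->
  (forall k s, I k s -> beval s b ->
    exists2 k', (k' < k)%N & runs p s Tb (I k')) ->
  runs (While b p) s (k * (Tb + (bcost b).+1) + (bcost b).+1)
    (fun s' => (exists k', I k' s') /\ ~~ beval s' b).
Proof.
move=> + H; elim/ltn_ind: k s => k IH s Iks.
have [bs|bs] := boolP (beval s b); last first.
  exists (bcost b).+1, s; split; [exact: ExecWhileStop|exact: leq_addl|].
  by split=> //; exists k.
have [k' kk [c [s1 [e1 c1 I1]]]] := H _ _ Iks bs.
have [d [s2 [e2 d2 Q2]]] := IH k' kk s1 I1.
exists (bcost b + c + d).+1, s2; split=> //; first exact: ExecWhileStep e1 e2.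
have : (k'.+1 * (Tb + (bcost b).+1) <= k * (Tb + (bcost b).+1))%N.
  by rewrite leq_mul2r kk orbT.
by rewrite mulSn; lia.
Qed.

(** On code without loops the relation [exec] can be replaced by the evaluator [seval] and the bound
    [scost], so that effects and costs are obtained by computation. *)
Fixpoint loop_free p : bool :=
  match p with
  | Seq p q | If _ p q => loop_free p && loop_free q
  | While _ _ => false
  | _ => true
  end.

Fixpoint seval s p : memory R :=
  match p with
  | ISet a e1 e2 => iset s a (ieval s e1) (ieval s e2)
  | RSet a e1 e2 => rset s a (ieval s e1) (reval s e2)
  | Seq p q => seval (seval s p) q
  | If b p q => if beval s b then seval s p else seval s q
  | _ => s
  end.

Fixpoint scost p : nat :=
  match p with
  | ISet _ e1 e2 => (icost e1 + icost e2).+1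
  | RSet _ e1 e2 => (icost e1 + rcost e2).+1
  | Seq p q => (scost p + scost q)%N
  | If b p q => (bcost b + maxn (scost p) (scost q)).+1
  | _ => 1%N
  end.

Lemma seval_seq s p q : seval s (Seq p q) = seval (seval s p) q.
Proof. by []. Qed.

Lemma runs_loop_free p s (Q : memory R -> Prop) : loop_free p -> Q (seval s p) ->
  runs p s (scost p) Q.
Proof.
move=> lp Qs; suff [c [e cT]] : exists c, exec p s c (seval s p) /\ (c <= scost p)%N.
  by exists c, (seval s p).
elim: p s lp {Qs} => /=.
- by move=> s _; exists 1%N; split=> //; exact: ExecSkip.
- by move=> a e1 e2 s _; eexists; split; [exact: ExecISet|].
- by move=> a e1 e2 s _; eexists; split; [exact: ExecRSet|].
- move=> p IHp q IHq s /andP[lp lq].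
  have [c [e1 c1]] := IHp s lp; have [d [e2 d2]] := IHq (seval s p) lq.
  by exists (c + d)%N; split; [exact: ExecSeq e1 e2|exact: leq_add].
- move=> b p IHp q IHq s /andP[lp lq]; case: ifPn => bs.
    have [c [e1 c1]] := IHp s lp; eexists; split; first exact: ExecIfTrue bs e1.
    by rewrite ltnS leq_add2l leq_max c1.
  have [c [e1 c1]] := IHq s lq; eexists; split; first exact: ExecIfFalse bs e1.
  by rewrite ltnS leq_add2l leq_max c1 orbT.
- by [].
Qed.

End Runs.

Notation reg a := (IGet a (IConst 0)).
Notation seti a e := (ISet a (IConst 0) e).
Notation "p ;; q" := (Seq p q) (at level 60, right associativity).

Section Program.
(* Integer arrays: 2 successor links and 3 predecessor links of the knots; the
   others are registers: 0 number of intervals, 1 output length, 4 loop counter,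
   5 knot whose rate is updated, 6 tree node, 7 number of peaks, 8 last linked
   knot, 9 deleted knot, 10 and 11 its neighbours.
   Real arrays: 0 partition points, 1 values, 2 output, 3 primitive of [f],
   4 signs of the knots, 5 tournament tree over the rates, in which the children
   of node [i] are [2 i] and [2 i + 1] and knot [j] sits at the leaf [n + 1 + j]. *)
Definition leaf (e : iexp) := IAdd (IAdd (reg 0) (IConst 1)) e.

Definition rate_exp : rexp :=
  let b := reg 5 in let a := IGet 3 b in let c := IGet 2 b in
  let gap r i j := RSub (RGet r j) (RGet r i) in
  RDiv (RSub (RMul (gap 4 a b) (gap 0 b c)) (RMul (gap 4 b c) (gap 0 a b)))
       (RSub (RMul (gap 3 b c) (gap 0 a b)) (RMul (gap 3 a b) (gap 0 b c))).

Definition node := reg 6.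
Definition child1 := IAdd node node.
Definition child2 := IAdd (IAdd node node) (IConst 1).

Definition set_leaf : cmd :=
  RSet 5 (leaf (reg 5)) rate_exp ;; seti 6 (IHalf (leaf (reg 5))).

Definition pull_up : cmd :=
  If (BRLe (RGet 5 child1) (RGet 5 child2))
    (RSet 5 node (RGet 5 child2)) (RSet 5 node (RGet 5 child1)) ;;
  seti 6 (IHalf node).

Definition update_rate : cmd :=
  set_leaf ;; While (BILe (IConst 1) node) pull_up.

Definition descend : cmd :=
  While (BILe node (reg 0))
    (If (BRLe (RGet 5 child1) (RGet 5 child2)) (seti 6 child2) (seti 6 child1)).

(** Signs are -1, 0 or 1, so a difference of at least 2 means 1 followed by -1. *)
Definition is_peak e1 e2 := BRLe (RConst 2) (RSub (RGet 4 e1) (RGet 4 e2)).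

(** With [m] the current number of peaks, output cell [m - 1] is written at every deletion. The
    entry is provisional until the deletion that makes [m] drop, after which this cell is not
    written again. *)
Definition pick_knot : cmd :=
  seti 9 (ISub node (IAdd (reg 0) (IConst 1))) ;;
  RSet 2 (ISub (reg 7) (IConst 1)) (RDiv (RConst 1) (RGet 5 (IConst 1))) ;;
  seti 10 (IGet 3 (reg 9)) ;;
  seti 11 (IGet 2 (reg 9)).

Definition adjust (i j e : iexp) : cmd := If (is_peak i j) (seti 7 e) Skip.

(** With its sign and both links reset to 0, the removed knot gets rate 0, so it never wins against
    a positive rate. *)
Definition unlink_knot : cmd :=
  RSet 4 (reg 9) (RConst 0) ;;
  ISet 2 (reg 9) (IConst 0) ;; ISet 2 (reg 10) (reg 11) ;;
  ISet 3 (reg 9) (IConst 0) ;; ISet 3 (reg 11) (reg 10) ;;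
  seti 5 (reg 9).

Definition decr := ISub (reg 7) (IConst 1).
Definition incr := IAdd (reg 7) (IConst 1).

Definition delete_knot : cmd :=
  pick_knot ;; adjust (reg 10) (reg 9) decr ;; adjust (reg 9) (reg 11) decr ;;
  adjust (reg 10) (reg 11) incr ;; unlink_knot.

Definition main_step : cmd :=
  seti 6 (IConst 1) ;; descend ;; delete_knot ;;
  update_rate ;; seti 5 (reg 10) ;; update_rate ;; seti 5 (reg 11) ;; update_rate.

Definition main_loop : cmd := While (BILe (IConst 1) (reg 7)) main_step.

Definition next4 := IAdd (reg 4) (IConst 1).

Definition link_knot : cmd :=
  ISet 2 (reg 8) next4 ;; ISet 3 next4 (reg 8) ;;
  adjust (reg 8) next4 incr ;;
  seti 8 next4.

Definition scan_step : cmd :=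
  RSet 3 next4 (RAdd (RGet 3 (reg 4))
    (RMul (RGet 1 (reg 4)) (RSub (RGet 0 next4) (RGet 0 (reg 4))))) ;;
  If (BRLe (RGet 1 next4) (RGet 1 (reg 4)))
    (If (BRLe (RGet 1 (reg 4)) (RGet 1 next4)) Skip
      (RSet 4 next4 (RConst (- 1)) ;; link_knot))
    (RSet 4 next4 (RConst 1) ;; link_knot) ;;
  seti 4 next4.

(** The sentinel stored after the last value exceeds it by 1, so the ordinary scan step creates the
    knot of sign 1 at the right end. That knot finally becomes its own successor, as [nxt_last]
    requires. *)
Definition scan : cmd :=
  RSet 1 (reg 0) (RAdd (RGet 1 (ISub (reg 0) (IConst 1))) (RConst 1)) ;;
  While (BILe next4 (reg 0)) scan_step ;;
  ISet 2 (reg 0) (reg 0) ;; seti 1 (reg 7) ;; seti 4 (IConst 0).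

Definition init_rates : cmd :=
  While (BILe (reg 4) (reg 0))
    (seti 5 (reg 4) ;; update_rate ;; seti 4 next4).

Definition signatures_program : cmd := scan ;; init_rates ;; main_loop.

End Program.

(** * Verification of the program *)

Section Tournament.
Context {R : realType}.
Implicit Types (s : memory R) (W : nat -> R).

(** Nodes 1 to [n] are internal and nodes [n + 1] to [2 n + 1] are the [n + 1] leaves; this heap
    layout does not require a power of two. *)
Definition tree_ok n W := forall i, (0 < i <= n)%N ->
  W i = Num.max (W (i + i)%N) (W (i + i + 1)%N).

Definition depth n := (trunc_log 2 n).+1.

Lemma depthP n : (n < 2 ^ depth n)%N.
Proof. exact: trunc_log_ltn. Qed.

Lemma tree_root n W i : (0 < n)%N -> tree_ok n W -> (0 < i <= n + n + 1)%N -> W i <= W 1%N.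
Proof.
move=> n0 tW; elim/ltn_ind: i => i IH /andP[i0 iN].
have [->//|i1] := eqVneq i 1%N.
have hi : (0 < i./2 <= n)%N by lia.
apply: le_trans (IH i./2 _ _); [|by lia|by lia].
rewrite (tW _ hi) le_max.
have := odd_double_half i; rewrite -addnn; case: odd => /= E.
  by rewrite -{1 4}E addnC lexx orbT.
by rewrite -{1}E add0n lexx.
Qed.

Lemma row_update (T : Type) (m : nat -> nat -> T) (a i : nat) x a' : a' != a ->
  update m a i x a' = m a'.
Proof. by move=> H; rewrite /update (negbTE H). Qed.

Lemma run_update_rate s n : imem s 0 0 = n -> (imem s 5 0 <= n)%N ->
  tree_ok n (rmem s 5) ->
  runs update_rate s (scost set_leaf + (depth n * (scost pull_up + 5) + 5)) (fun s' =>
    [/\ forall a, a != 6%N -> imem s' a = imem s a,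
        forall a, a != 5%N -> rmem s' a = rmem s a,
        tree_ok n (rmem s' 5)
      & forall j, (j <= n)%N -> rmem s' 5 (n + 1 + j)%N =
          if j == imem s 5 0 then reval s rate_exp else rmem s 5 (n + 1 + j)%N]).
Proof.
move=> sn Jn tok.
apply: (@runs_seq _ _ _ _ _ _ (fun s1 => s1 = seval s set_leaf)).
  exact: runs_loop_free.
move=> _ ->.
pose J := imem s 5 0.
(* On the way up the maximum equation may fail only at the current node, whose index is below
   [2 ^ k]; so [k] bounds the remaining halvings. Index 0 means that the root is repaired. *)
pose I k s1 := [/\ forall a, a != 6%N -> imem s1 a = imem s a,
  forall a, a != 5%N -> rmem s1 a = rmem s a,
  (imem s1 6 0 < 2 ^ k)%N /\ (imem s1 6 0 <= n)%N,
  forall i, (0 < i <= n)%N -> i != imem s1 6 0 ->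
    rmem s1 5 i = Num.max (rmem s1 5 (i + i)%N) (rmem s1 5 (i + i + 1)%N)
  & forall j, (j <= n)%N -> rmem s1 5 (n + 1 + j)%N =
          if j == J then reval s rate_exp else rmem s 5 (n + 1 + j)%N].
apply: (runs_le _ _ (@runs_while _ _ _ (scost pull_up) I (depth n) _ _ _)); first by [].
- move=> s' [[k [i1 i2 [i3 i4] i5 i6]]] /= g; split=> // i ip.
  by apply: i5 => //; move: g ip; lia.
- rewrite /set_leaf /= sn -/J.
  have hN : ((n + 1 + J)./2 <= n)%N by rewrite /J; lia.
  split=> /=.
  + by move=> a a6; rewrite row_update.
  + by move=> a a5; rewrite row_update.
  + rewrite /update /=; split=> //; exact: leq_ltn_trans hN (depthP n).
  + move=> i ip; rewrite /update /= => iJ.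
    have -> : (i == n + 1 + J)%N = false by apply/negbTE; lia.
    have -> : (i + i == n + 1 + J)%N = false by apply/negbTE; lia.
    have -> : (i + i + 1 == n + 1 + J)%N = false by apply/negbTE; lia.
    exact: tok.
  + by move=> j jn; rewrite /update /= eqn_add2l.
- move=> k s1 [i1 i2 [i3 i4] i5 i6] /= g.
  exists k.-1; first by case: k i3 => //; rewrite expn0; lia.
  apply: runs_loop_free => //.
  pose i := imem s1 6 0.
  have g' : (0 < i)%N by [].
  pose x := Num.max (rmem s1 5 (i + i)%N) (rmem s1 5 (i + i + 1)%N).
  have E : seval s1 pull_up = iset (rset s1 5 i x) 6 0 i./2.
    by rewrite /pull_up /= /x maxEle -/i; case: ifP => _; rewrite /rset /update.
  rewrite E; split=> /=.
  + by move=> a a6; rewrite row_update// i1.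
  + by move=> a a5; rewrite row_update// i2.
  + rewrite /update /=; split; last by move: i4; rewrite -/i; lia.
    case: k i3 => [|k]; rewrite -/i; first by rewrite expn0; lia.
    by rewrite expnS mul2n /= => H; rewrite ltn_half_double.
  + rewrite /update /= => j jp ji.
    have -> : (j + j == i)%N = false by apply/negbTE; move: ji; lia.
    have -> : (j + j + 1 == i)%N = false by apply/negbTE; move: ji; lia.
    by case: (eqVneq j i) => [->//|ji']; apply: i5.
  + move=> j jn; rewrite /update /= -i6//.
    by have -> : (n + 1 + j == i)%N = false by apply/negbTE; move: i4; rewrite -/i; lia.
Qed.

Lemma run_descend s n : imem s 0 0 = n -> (0 < n)%N -> tree_ok n (rmem s 5) ->
  imem s 6 0 = 1%N ->
  runs descend s (depth n * 31 + 6) (fun s' =>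
    [/\ forall a, a != 6%N -> imem s' a = imem s a, rmem s' = rmem s,
        (n < imem s' 6 0 <= n + n + 1)%N & rmem s 5 (imem s' 6 0) = rmem s 5 1%N]).
Proof.
move=> sn n0 tok s61.
(* The current node carries the value of the root, and its index at least doubles at each step, so
   it exceeds [n] after at most [k] further steps. *)
pose I k s1 := [/\ forall a, a != 6%N -> imem s1 a = imem s a, rmem s1 = rmem s,
  (0 < imem s1 6 0 <= n + n + 1)%N /\ (n < imem s1 6 0 * 2 ^ k)%N
  & rmem s 5 (imem s1 6 0) = rmem s 5 1%N].
(* The body costs 25 and the test with its loop overhead 6, whence the 31 per level. *)
apply: (runs_le _ _ (@runs_while _ _ _ 25 I (depth n) _ _ _)); first by [].
- move=> s' [[k [i1 i2 [i3 i4] i5]]] /= g; split=> //.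
  by move: g; rewrite (i1 0%N)// sn -ltnNge => ->; case/andP: i3.
- split; rewrite ?s61//; split; first lia.
  by rewrite mul1n depthP.
- move=> k s1 [i1 i2 [i3 i4] i5] /=; rewrite (i1 0%N)// sn => g.
  have k0 : (0 < k)%N by case: k i4 => //; rewrite expn0; lia.
  exists k.-1; first by rewrite ltn_predL.
  apply: (runs_le (leqnn _) (fun _ H => H)).
  apply: (runs_le _ (fun _ H => H) (runs_loop_free _ _)) => //.
  pose i := imem s1 6 0.
  have pk : (2 ^ k = 2 * 2 ^ k.-1)%N by rewrite -expnS prednK.
  have ti : rmem s 5 i = Num.max (rmem s 5 (i + i)%N) (rmem s 5 (i + i + 1)%N).
    by apply: tok; rewrite /i g andbT; case/andP: i3.
  rewrite -/i in g i3 i4 i5.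
  rewrite /= -/i i2; case: ifPn => H; split=> //=.
  + by move=> a a6; rewrite row_update// i1.
  + by rewrite /update /=; split; [lia|move: i4; rewrite pk; nia].
  + by rewrite /update /= -i5 ti; apply/esym/max_idPr.
  + by move=> a a6; rewrite row_update// i1.
  + by rewrite /update /=; split; [lia|move: i4; rewrite pk; nia].
  + by rewrite /update /= -i5 ti; apply/esym/max_idPl; rewrite ltW// ltNge.
Qed.

End Tournament.

(** * The deletion loop *)

Section MainLoop.
Context {R : realType} (t : seq R) (n : nat).
Hypotheses (t01 : unit_partition t) (size_t : size t = n.+1) (n0 : (0 < n)%N).
Context (v : nat -> R) (f : R -> R).
Hypothesis fv : step_values t n f v.
Context (M : nat).
Implicit Types (s : memory R).
Local Notation F := (cell_sum t v).
Local Notation rate_in s := (rate t F (rmem s 4) (imem s 2) (imem s 3)).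
Local Notation flow_in s := (flow t n F (rmem s 4) (imem s 2) (imem s 3)).
Local Notation peaks_in s := (npeaks n (rmem s 4) (imem s 2)).

Record static s : Prop := Static {
  static_n : imem s 0 0 = n;
  static_M : imem s 1 0 = M;
  static_t : rmem s 0 = nth 0 t;
  static_F : forall j, (j <= n)%N -> rmem s 3 j = F j
}.

Definition links_le s := forall j, (j <= n)%N -> (imem s 2 j <= n)%N /\ (imem s 3 j <= n)%N.

Lemma static_frame s s' : static s -> imem s' 0 = imem s 0 -> imem s' 1 = imem s 1 ->
  rmem s' 0 = rmem s 0 -> rmem s' 3 = rmem s 3 -> static s'.
Proof. by move=> [h1 h2 h3 h4] E0 E1 E2 E3; split; rewrite ?E0 ?E1 ?E2 ?E3. Qed.

Lemma eval_rate s : static s -> links_le s -> (imem s 5 0 <= n)%N ->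
  reval s rate_exp = rate_in s (imem s 5 0).
Proof.
move=> [_ _ st sF] L Jn; have [L1 L2] := L _ Jn.
rewrite /rate_exp /= st !sF// /rate /bend; congr (_ / _); ring.
Qed.

Definition update_cost := (scost set_leaf + (depth n * (scost pull_up + 5) + 5))%N.

Lemma run_update s : static s -> links_le s -> (imem s 5 0 <= n)%N -> tree_ok n (rmem s 5) ->
  runs update_rate s update_cost (fun s' =>
    [/\ forall a, a != 6%N -> imem s' a = imem s a,
        forall a, a != 5%N -> rmem s' a = rmem s a,
        tree_ok n (rmem s' 5)
      & forall j, (j <= n)%N -> rmem s' 5 (n + 1 + j)%N =
          if j == imem s 5 0 then rate_in s j else rmem s 5 (n + 1 + j)%N]).
Proof.
move=> ss L Jn tok; apply: runs_le (run_update_rate (static_n ss) Jn tok) => //.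
move=> s' [h1 h2 h3 h4]; split=> // j jn; rewrite h4//.
by case: eqP => // ->; exact: eval_rate.
Qed.

Lemma sign_gap (x y : R) : [\/ x = 0, x = 1 | x = -1] -> [\/ y = 0, y = 1 | y = -1] ->
  (2 <= x - y) = (x == 1) && (y == -1).
Proof.
have h1 : (0 == 1 :> R) = false by rewrite eq_sym oner_eq0.
have h2 : (0 == -1 :> R) = false by rewrite eq_sym oppr_eq0 oner_eq0.
have h3 : (-1 == 1 :> R) = false by rewrite eq_sym one_eqN1.
case=> ->; case=> ->; rewrite ?eqxx ?one_eqN1 ?h1 ?h2 ?h3 /=; apply/idP; lra.
Qed.

Definition peak_of (e : nat -> R) i j := (e i == 1) && (e j == -1).

Lemma seval_adjust s i j e : (forall k, [\/ rmem s 4 k = 0, rmem s 4 k = 1 | rmem s 4 k = -1]) ->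
  let s' := seval s (adjust i j e) in
  [/\ forall a, a != 7%N -> imem s' a = imem s a, rmem s' = rmem s
    & imem s' 7 0 = if peak_of (rmem s 4) (ieval s i) (ieval s j) then ieval s e else imem s 7 0].
Proof.
move=> sgn /=; rewrite /peak_of -sign_gap//.
by case: ifP => // _; split=> //= a a7; rewrite row_update.
Qed.

Definition signs_ok s := forall k, [\/ rmem s 4 k = 0, rmem s 4 k = 1 | rmem s 4 k = -1].

Lemma seval_delete s : signs_ok s -> imem s 0 0 = n ->
  let b := (imem s 6 0 - (n + 1))%N in let a := imem s 3 b in let c := imem s 2 b in
  let s' := seval s delete_knot in let e := rmem s 4 in
  [/\ forall d, d \notin [:: 2; 3; 5; 7; 9; 10; 11]%N -> imem s' d = imem s d,
      forall d, d \notin [:: 2; 4]%N -> rmem s' d = rmem s d,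
      [/\ imem s' 2 = setn (setn (imem s 2) b 0%N) a c,
        imem s' 3 = setn (setn (imem s 3) b 0%N) c a & rmem s' 4 = setn e b 0],
      [/\ imem s' 5 0 = b, imem s' 10 0 = a & imem s' 11 0 = c] &
      imem s' 7 0 = (imem s 7 0 - peak_of e a b - peak_of e b c + peak_of e a c)%N /\
      rmem s' 2 = setn (rmem s 2) (imem s 7 0 - 1)%N (rmem s 5 1%N)^-1].
Proof.
move=> sgn sn b a c s' e.
pose s1 := seval s pick_knot.
pose s2 := seval s1 (adjust (reg 10) (reg 9) decr).
pose s3 := seval s2 (adjust (reg 9) (reg 11) decr).
pose s4 := seval s3 (adjust (reg 10) (reg 11) incr).
have s1E : s1 = iset (iset (rset (iset s 9 0 b) 2 (imem s 7 0 - 1)%N (rmem s 5 1%N)^-1) 10 0 a) 11 0 c.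
  by rewrite /s1 /= sn div1r.
have sE : s' = seval s4 unlink_knot.
  rewrite /s' /delete_knot (seval_seq s pick_knot) (seval_seq s1 (adjust _ _ _)).
  by rewrite (seval_seq s2 (adjust _ _ _)) (seval_seq s3 (adjust _ _ _)).
clearbody s1.
have r1 : rmem s1 4 = rmem s 4 by rewrite s1E.
have [i2 r2 m2] := @seval_adjust s1 (reg 10) (reg 9) decr ltac:(by rewrite r1).
rewrite -/s2 in i2 r2 m2; clearbody s2.
have [|i3 r3 m3] := @seval_adjust s2 (reg 9) (reg 11) decr.
  by rewrite r2 r1.
rewrite -/s3 in i3 r3 m3; clearbody s3.
have [|i4 r4 m4] := @seval_adjust s3 (reg 10) (reg 11) incr.
  by rewrite r3 r2 r1.
rewrite -/s4 in i4 r4 m4; clearbody s4.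
have I4 d : d != 7%N -> imem s4 d = imem s1 d by move=> d7; rewrite i4// i3// i2.
have R4 : rmem s4 = rmem s1 by rewrite r4 r3 r2.
have [e9 e10 e11] : [/\ imem s4 9 0 = b, imem s4 10 0 = a & imem s4 11 0 = c].
  by rewrite !I4// s1E.
have M4 : imem s4 7 0 = (imem s 7 0 - peak_of e a b - peak_of e b c + peak_of e a c)%N.
  rewrite m4 /= m3 /= m2 /= r3 r2 !(i3 10%N) // !(i3 11%N)// !(i2 _)// s1E /=.
  rewrite /update /= -/e.
  by do 3!case: ifP => _; lia.
have {}sE : s' = iset (iset (iset (iset (iset (rset s4 4 b 0) 2 b 0) 2 a c) 3 b 0) 3 c a) 5 0 b.
  by rewrite sE /unlink_knot /= !row_update//= e9 e10 e11.
rewrite sE; split=> /=.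
- move=> d; rewrite !inE !negb_or => /and5P[d2 d3 d5 d7 /and3P[d9 d10 d11]].
  by rewrite !row_update// I4// s1E /= !row_update.
- move=> d; rewrite !inE !negb_or => /andP[d2 d4].
  by rewrite !row_update// R4 s1E /= !row_update.
- split; rewrite /update /setn /=.
  + by rewrite I4// s1E.
  + by rewrite I4// s1E.
  + by rewrite R4 s1E.
- by rewrite /update /= e10 e11.
- split; first by rewrite /update /= M4.
  by rewrite row_update// R4 s1E.
Qed.

Definition same s s' :=
  (forall a, a \notin [:: 4; 5; 6]%N -> imem s' a = imem s a) /\
  (forall a, a != 5%N -> rmem s' a = rmem s a).

Lemma same_static s s' : same s s' -> static s -> static s'.
Proof. by move=> [i r] ss; apply: static_frame ss _ _ _ _; rewrite ?i ?r. Qed.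

Lemma same_links_le s s' : same s s' -> links_le s -> links_le s'.
Proof. by move=> [i r] L j jn; rewrite !i//; exact: L. Qed.

Lemma same_rate s s' : same s s' -> rate_in s' = rate_in s.
Proof. by move=> [i r]; rewrite !i// r. Qed.

Lemma same_trans s1 s2 s3 : same s1 s2 -> same s2 s3 -> same s1 s3.
Proof. by move=> [i r] [i' r']; split=> a H; rewrite ?i' ?i ?r' ?r. Qed.

Lemma same_update s s' : (forall a, a != 6%N -> imem s' a = imem s a) ->
  (forall a, a != 5%N -> rmem s' a = rmem s a) -> same s s'.
Proof.
by move=> i r; split=> // a; rewrite !inE !negb_or => /and3P[_ _]; exact: i.
Qed.

Lemma same_seti5 s e : same s (seval s (seti 5 e)).
Proof. by split=> a //=; rewrite !inE !negb_or => /and3P[_ a5 _]; rewrite row_update. Qed.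

Lemma same_seti4 s e : same s (seval s (seti 4 e)).
Proof. by split=> a //=; rewrite !inE !negb_or => /and3P[a4 _ _]; rewrite row_update. Qed.

Definition refresh : cmd :=
  update_rate ;; seti 5 (reg 10) ;; update_rate ;; seti 5 (reg 11) ;; update_rate.

Definition refresh_cost := (3 * update_cost + 8)%N.

Lemma run_refresh s a b c : static s -> links_le s -> tree_ok n (rmem s 5) ->
  imem s 5 0 = b -> imem s 10 0 = a -> imem s 11 0 = c ->
  (a <= n)%N -> (b <= n)%N -> (c <= n)%N ->
  runs refresh s refresh_cost (fun s' => [/\ same s s', tree_ok n (rmem s' 5) &
    forall j, (j <= n)%N -> rmem s' 5 (n + 1 + j)%N =
      if j \in [:: a; b; c] then rate_in s j else rmem s 5 (n + 1 + j)%N]).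
Proof.
move=> ss L tok s5 s10 s11 an bn cn.
have -> : refresh_cost = (update_cost + (4 + (update_cost + (4 + update_cost))))%N.
  by rewrite /refresh_cost; lia.
apply: runs_seq (run_update ss L _ tok) _; first by rewrite s5.
move=> s1 [i1 r1 t1 l1]; have S1 := same_update i1 r1.
apply: (@runs_seq _ _ _ _ 4 _ (fun s2 => s2 = seval s1 (seti 5 (reg 10)))).
  exact: (@runs_loop_free _ (seti 5 (reg 10))).
move=> s2 s2E; have S2 := same_seti5 s1 (reg 10); rewrite -s2E in S2.
have S02 := same_trans S1 S2.
have J2 : imem s2 5 0 = a by rewrite s2E /= /update /= i1.
have W2 : rmem s2 5 = rmem s1 5 by rewrite s2E.
have T2 : tree_ok n (rmem s2 5) by rewrite W2.
have N2 : (imem s2 5 0 <= n)%N by rewrite J2.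
apply: runs_seq (run_update (same_static S02 ss) (same_links_le S02 L) N2 T2) _.
move=> s3 [i3 r3 t3 l3]; have S3 := same_update i3 r3.
apply: (@runs_seq _ _ _ _ 4 _ (fun s4 => s4 = seval s3 (seti 5 (reg 11)))).
  exact: (@runs_loop_free _ (seti 5 (reg 11))).
move=> s4 s4E; have S4 := same_seti5 s3 (reg 11); rewrite -s4E in S4.
have S04 := same_trans S02 (same_trans S3 S4).
have J4 : imem s4 5 0 = c.
  by rewrite s4E /= /update /= i3// s2E /= row_update// i1.
have W4 : rmem s4 5 = rmem s3 5 by rewrite s4E.
have T4 : tree_ok n (rmem s4 5) by rewrite W4.
have N4 : (imem s4 5 0 <= n)%N by rewrite J4.
apply: runs_le (run_update (same_static S04 ss) (same_links_le S04 L) N4 T4) => //.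
move=> s5' [i5 r5 t5 l5]; have S5 := same_update i5 r5; split=> //.
  exact: same_trans S04 S5.
move=> j jn; rewrite l5// (same_rate S04) J4 W4 l3// (same_rate S02) J2 W2 l1// s5.
by rewrite !inE; do 3!case: eqP => _ //.
Qed.

(** [M] is the initial number of peaks and the length of the output. [inv_out] speaks only of cells
    from the current number of peaks on, since a cell below it may be unset or provisional. *)
Record inv s : Prop := Inv {
  inv_static : static s;
  inv_flow : exists al, flow_in s al;
  inv_tree : tree_ok n (rmem s 5);
  inv_leaf : forall j, (j <= n)%N -> rmem s 5 (n + 1 + j)%N = rate_in s j;
  inv_peaks : imem s 7 0 = peaks_in s;
  inv_out : forall k, (imem s 7 0 <= k < M)%N ->
    rmem s 2 k = signature t f k /\ 0 < signature t f k
}.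

Definition step_cost := (3 + (depth n * 31 + 6 + (scost delete_knot + refresh_cost)))%N.

Lemma run_main_step s : inv s -> (0 < imem s 7 0)%N ->
  runs main_step s step_cost (fun s' =>
    inv s' /\ (nalive n (rmem s' 4) < nalive n (rmem s 4))%N).
Proof.
move=> [ss [al W] tok lf pk out] m0.
have K := flow_knots W.
apply: (@runs_seq _ _ _ _ 3 _ (fun s1 => s1 = iset s 6 0 1%N)).
  exact: (@runs_loop_free _ (seti 6 (IConst 1))).
move=> s1 s1E.
apply: (@runs_seq _ _ _ _ (depth n * 31 + 6) _ (fun s2 =>
    [/\ forall a, a != 6%N -> imem s2 a = imem s a, rmem s2 = rmem s,
        (n < imem s2 6 0 <= n + n + 1)%N & rmem s 5 (imem s2 6 0) = rmem s 5 1%N])).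
  apply: runs_le (@run_descend _ s1 n _ n0 _ _) => //.
  - move=> s2 [h1 h2 h3 h4]; split=> //; rewrite ?h2 ?s1E//.
      by move=> a a6; rewrite h1// s1E /= row_update.
    by move: h4; rewrite s1E.
  - by rewrite s1E /= row_update// (static_n ss).
  - by rewrite s1E.
  - by rewrite s1E /= /update.
move=> s2 [i2 r2 /andP[nb bN] root].
pose b := (imem s2 6 0 - (n + 1))%N.
have bE : (n + 1 + b)%N = imem s2 6 0 by rewrite /b; lia.
have bn : (b <= n)%N by rewrite /b; lia.
have rbE : rate_in s b = rmem s 5 1%N by rewrite -lf// bE root.
have rmax j : (j <= n)%N -> rate_in s j <= rate_in s b.
  by move=> jn; rewrite rbE -lf//; apply: tree_root n0 tok _; lia.
have rb : 0 < rate_in s b.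
  have [|j jn rj] := exists_rate_gt0 t01 size_t n0 W; first by rewrite -pk.
  exact: lt_le_trans rj (rmax _ jn).
have sgn2 : signs_ok s2 by move=> k; rewrite r2; exact: (eps_sign K).
have sn2 : imem s2 0 0 = n by rewrite i2// (static_n ss).
have := seval_delete sgn2 sn2; cbv zeta; rewrite -/b r2 !i2//.
set s3 := seval s2 delete_knot.
set a := imem s 3 b; set c := imem s 2 b.
move=> [i3 r3 [n3 p3 e3] [b3 a3 c3] [m3 o3]].
apply: (@runs_seq _ _ _ _ _ _ (fun s' => s' = s3)); first exact: runs_loop_free.
move=> _ ->.
have W' := flow_delete t01 size_t n0 W bn rb rmax; rewrite -e3 -n3 -p3 in W'.
have [bord _ cn _ _] := event_order t01 size_t n0 W bn rb.
have L : links_le s3 by move=> j jn; exact: (flow_link_le W').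
have [cn' an] := flow_link_le W bn.
have ss3 : static s3 by apply: static_frame ss _ _ _ _; rewrite ?i3 ?r3 ?r2 ?i2.
have W3 : rmem s3 5 = rmem s 5 by rewrite r3.
have tok3 : tree_ok n (rmem s3 5) by rewrite W3.
apply: runs_le (run_refresh ss3 L tok3 b3 a3 c3 an bn cn) => //.
move=> s' [S tok' lf']; have [iS rS] := S.
have [E2 E3 E4 E7] : [/\ imem s' 2 = imem s3 2, imem s' 3 = imem s3 3,
    rmem s' 4 = rmem s3 4 & imem s' 7 = imem s3 7] by rewrite !iS// !rS.
(* Having a single sign, [b] cannot both end a peak and start one. Hence the number of peaks drops
   by at most one per deletion and no signature is skipped. *)
have p1 : (peak_of (rmem s 4) a b + peak_of (rmem s 4) b c <= 1)%N.
  rewrite /peak_of; case: (eqVneq (rmem s 4 b) 1) => [->|_].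
    by rewrite one_eqN1 andbF add0n leq_b1.
  by rewrite andFb addn0 leq_b1.
have mE : imem s3 7 0 = npeaks n (rmem s3 4) (imem s3 2).
  have := npeaks_delete t01 size_t n0 W bn rb; rewrite -e3 -n3 -pk m3.
  have [na _] := event_links t01 size_t n0 W bn rb.
  rewrite /peak na -/a -/c -/(peak_of (rmem s 4) a b) -/(peak_of (rmem s 4) b c)
    -/(peak_of (rmem s 4) a c); lia.
split; last by rewrite E4 e3; exact: (nalive_delete t01 size_t n0 W).
split.
- exact: same_static S ss3.
- by exists (rate_in s b)^-1; rewrite E2 E3 E4.
- exact: tok'.
- move=> j jn; rewrite lf'// E2 E3 E4; case: ifPn => //.
  rewrite !inE !negb_or => /and3P[ja jb jc].
  rewrite W3 lf// e3 n3 p3; apply/esym.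
  exact: (rate_delete t01 size_t n0 W bn rb jn jb ja jc).
- by rewrite E7 E2 E4.
- move=> k; rewrite E7 rS// o3 mE => /andP[mk kM].
  have le_al : signature t f k <= (rate_in s b)^-1.
    apply: (signature_le_taut t01 size_t n0 fv (flow_knots W') (flow_taut W')) mk.
      exact: (flow_tube W').
    exact: (flow_ge0 W').
  have taut' := event_taut t01 size_t n0 W bn rb rmax.
  (* A cell to be certified is either the one just written, after a drop by one, or one settled
     earlier. *)
  rewrite /setn; case: eqVneq => [km|km]; last first.
    apply: out; rewrite kM andbT.
    move: km mk; rewrite -mE m3; case: (leqP (imem s 7 0) k) => // km'.
    lia.
  have kn : (k < npeaks n (rmem s 4) (imem s 2))%N by rewrite -pk km; lia.
  have ge_al := signature_ge_taut t01 size_t n0 fv K taut' kn.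
  rewrite -rbE; have E : (rate_in s b)^-1 = signature t f k.
    by apply/eqP; rewrite eq_le ge_al le_al.
  by rewrite E -E invr_gt0.
Qed.

Lemma run_main_loop s : inv s -> runs main_loop s (n * (step_cost + 5) + 5) (fun s' =>
  inv s' /\ imem s' 7 0 = 0%N).
Proof.
move=> si; pose I k s1 := inv s1 /\ nalive n (rmem s1 4) = k.
apply: (runs_le _ _ (@runs_while _ _ _ step_cost I (nalive n (rmem s 4)) s _ _)).
- by rewrite leq_add2r leq_mul2r nalive_le orbT.
- by move=> s' [[k [H _]] /= g]; split=> //; move: g; rewrite -ltnNge ltnS leqn0 => /eqP.
- by [].
- move=> k s1 [i1 k1] /= g.
  have [c [s2 [e2 c2 [i2 lt2]]]] := run_main_step i1 g.
  by exists (nalive n (rmem s2 4)); [rewrite -k1|exists c, s2; split].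
Qed.

Definition init_step_cost := (4 + (update_cost + 6))%N.

(** The zero tree already satisfies the maximum equations, so the leaves can be filled one by one
    with ordinary updates. [inv_out] holds vacuously, the number of peaks still being [M]. *)
Lemma run_init_rates s al : static s -> flow_in s al -> (forall i, rmem s 5 i = 0) ->
  imem s 4 0 = 0%N -> imem s 7 0 = peaks_in s -> imem s 7 0 = M ->
  runs init_rates s (n.+1 * (init_step_cost + 6) + 6) inv.
Proof.
move=> ss W W0 s4 s7 sM.
have L : links_le s by move=> j jn; exact: (flow_link_le W).
pose I k s1 := [/\ same s s1, tree_ok n (rmem s1 5), (imem s1 4 0 + k = n.+1)%N
  & forall j, (j < imem s1 4 0)%N -> rmem s1 5 (n + 1 + j)%N = rate_in s j].
apply: (runs_le (leqnn _) _ (@runs_while _ _ _ init_step_cost I n.+1 s _ _)).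
- move=> s' [[k [S tok jk lf]] /= g].
  have [iS rS] := S.
  have s0 : imem s' 0 0 = n by rewrite iS// (static_n ss).
  have jE : imem s' 4 0 = n.+1 by move: g; rewrite s0; lia.
  split.
  + exact: same_static S ss.
  + by exists al; rewrite !iS// rS.
  + by [].
  + by move=> j jn; rewrite lf ?jE// (same_rate S).
  + by rewrite !iS// rS.
  + by move=> k'; rewrite iS// sM; lia.
- split=> [//||//|j]; rewrite ?s4//.
  by move=> i _; rewrite !W0 maxxx.
- move=> k s1 [S tok jk lf] /= g; have [iS rS] := S.
  have s0 : imem s1 0 0 = n by rewrite iS// (static_n ss).
  rewrite s0 in g.
  exists k.-1; first by lia.
  apply: (@runs_seq _ _ _ _ 4 _ (fun s2 => s2 = seval s1 (seti 5 (reg 4)))).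
    exact: (@runs_loop_free _ (seti 5 (reg 4))).
  move=> s2 s2E; have S2 := same_seti5 s1 (reg 4); rewrite -s2E in S2.
  have S02 := same_trans S S2.
  have J2 : imem s2 5 0 = imem s1 4 0 by rewrite s2E.
  have W2 : rmem s2 5 = rmem s1 5 by rewrite s2E.
  have T2 : tree_ok n (rmem s2 5) by rewrite W2.
  have N2 : (imem s2 5 0 <= n)%N by rewrite J2.
  apply: runs_seq (run_update (same_static S02 ss) (same_links_le S02 L) N2 T2) _.
  move=> s3 [i3 r3 t3 l3]; have S3 := same_update i3 r3.
  apply: (@runs_loop_free _ (seti 4 next4)) => //.
  have j3 : imem s3 4 0 = imem s1 4 0 by rewrite i3// s2E.
  have S4 := same_seti4 s3 next4.
  split.
  + exact: same_trans S02 (same_trans S3 S4).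
  + exact: t3.
  + by rewrite /= /update /= j3; lia.
  + move=> j; rewrite /= /update /= j3 addn1 ltnS => jj.
    rewrite l3; last by lia.
    rewrite J2 (same_rate S02) W2; case: eqP => [->//|/eqP jne].
    by apply: lf; rewrite ltn_neqAle jne.
Qed.

End MainLoop.

Section Setn.
Context (T : Type).
Implicit Types (h : nat -> T).

Lemma setn_at h i x : setn h i x i = x.
Proof. by rewrite /setn eqxx. Qed.

Lemma setn_lt h i x j : (j < i)%N -> setn h i x j = h j.
Proof. by move=> ji; rewrite /setn ltn_eqF. Qed.

Lemma setn_ne h i x j : j != i -> setn h i x j = h j.
Proof. by rewrite /setn => /negbTE ->. Qed.

Lemma setn_gt h i x j : (i < j)%N -> setn h i x j = h j.
Proof. by move=> ji; rewrite /setn gtn_eqF. Qed.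

End Setn.

(** * Linking the knots from left to right *)

Section LinkKnot.
Context {R : realType}.
Implicit Types (eps u : nat -> R) (nxt prv : nat -> nat).

(** Indices up to [j] have been treated and [l] is the last knot linked. Its successor is still
    unknown, so the links form a complete chain only on the range from 0 to [l]. *)
Record scanned u j l eps nxt prv : Prop := Scanned {
  scanned_first : eps 0%N = 0;
  scanned_sign : forall i, (0 < i <= j)%N ->
    [\/ eps i = 0 /\ u i = u i.-1, eps i = 1 /\ u i.-1 < u i | eps i = -1 /\ u i < u i.-1];
  scanned_rest : forall i, (j < i)%N -> eps i = 0;
  scanned_last : [/\ (l <= j)%N, alive eps l & forall i, (l < i)%N -> eps i = 0];
  scanned_linked : linked l eps nxt prv;
  scanned_prv : prv 0%N = 0%N;
  scanned_dead : forall b, ~~ alive eps b -> nxt b = 0%N /\ prv b = 0%N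
}.

Lemma scanned_skip u j l eps nxt prv : u j.+1 = u j ->
  scanned u j l eps nxt prv -> scanned u j.+1 l eps nxt prv.
Proof.
move=> uj [h1 h2 h3 [h4 h5 h6] h7 h8 h9]; split=> //.
- move=> i /andP[i0]; rewrite leq_eqVlt => /predU1P[->|ij]; last by apply: h2; rewrite i0.
  by constructor 1; rewrite h3.
- by move=> i ij; apply: h3; exact: ltnW.
- by split=> //; exact: leqW.
Qed.

Section Link.
Context (u : nat -> R) (j l : nat) (eps : nat -> R) (nxt prv : nat -> nat) (e : R).
Hypotheses (S : scanned u j l eps nxt prv)
  (je : (e = 1 /\ u j < u j.+1) \/ (e = -1 /\ u j.+1 < u j)).
Local Notation eps' := (setn eps j.+1 e).
Local Notation nxt' := (setn nxt l j.+1).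
Local Notation prv' := (setn prv j.+1 l).

Let e0 : e != 0.
Proof. by case: je => -[-> _]; rewrite ?oppr_eq0 oner_eq0. Qed.

Lemma alive_link b : (b <= j)%N -> alive eps' b = alive eps b.
Proof. by move=> bj; rewrite /alive setn_lt. Qed.

Lemma alive_le b : (b <= j)%N -> alive eps b -> (b <= l)%N.
Proof.
have [_ _ _ [_ _ lz] _ _ _] := S.
move=> bj; apply: contraTT; rewrite -ltnNge => lb.
by rewrite /alive lz// eqxx orbF -lt0n (leq_ltn_trans _ lb).
Qed.

Lemma alive_new : alive eps' j.+1.
Proof. by rewrite /alive setn_at e0 orbT. Qed.

Lemma linked_link : linked j.+1 eps' nxt' prv'.
Proof.
have [h1 h2 h3 [lj al1 lz] [hn hp] h8 h9] := S.
split=> b ab.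
- rewrite ltnS => bj; rewrite alive_link// in ab.
  have := alive_le bj ab; rewrite leq_eqVlt => /predU1P[->|bl].
    rewrite setn_at alive_new setn_at leqnn ltnS lj; split=> // i /andP[li ij].
    by rewrite setn_lt// lz.
  have [/andP[bn nl] an pb z] := hn b ab bl.
  have nj : (nxt b <= j)%N := leq_trans nl lj.
  rewrite setn_lt// alive_link// setn_lt//; split=> //.
    by rewrite bn leqW.
  move=> i /andP[bi inn]; rewrite setn_lt; first by apply: z; rewrite bi.
  by rewrite ltnS (leq_trans (ltnW inn)).
- move=> /andP[b0]; rewrite leq_eqVlt => /predU1P[->|].
    by rewrite setn_at ltnS lj alive_link// al1 setn_at.
  rewrite ltnS => bj; rewrite alive_link// in ab.
  have bl := alive_le bj ab.
  have [|pb ap np] := hp b ab; first by rewrite b0.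
  rewrite setn_lt// alive_link ?(leq_trans (ltnW pb))// setn_lt//.
  exact: leq_trans pb bl.
Qed.

Lemma scanned_link : scanned u j.+1 j.+1 eps' nxt' prv'.
Proof.
have [h1 h2 h3 [lj al1 lz] hl h8 h9] := S.
split=> //.
- move=> i /andP[i0]; rewrite leq_eqVlt => /predU1P[->|ij].
    by rewrite setn_at /=; case: je => -[-> H]; [constructor 2|constructor 3].
  by rewrite setn_lt//; apply: h2; rewrite i0.
- by move=> i ij; rewrite setn_gt//; apply: h3; exact: ltnW.
- split=> //; first exact: alive_new.
  by move=> i ij; rewrite setn_gt//; apply: h3; exact: ltnW.
- exact: linked_link.
- move=> b; have [->|bj] := eqVneq b j.+1; first by rewrite alive_new.
  rewrite /alive /setn (negbTE bj) => db; have [n1 p1] := h9 b db.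
  by rewrite n1 p1; case: eqVneq => // bl; move: al1; rewrite /alive -bl (negbTE db).
Qed.

(** The block starting at [l] was not counted while its right end was unknown; fixing that end adds
    at most this one peak. *)
Lemma npeaks_link :
  npeaks j.+1 eps' nxt' = (npeaks l eps nxt + peak_of eps' l j.+1)%N.
Proof.
have [h1 h2 h3 [lj al1 lz] [hn hp] h8 h9] := S.
rewrite /npeaks (@big_cat_nat _ _ _ l)//=; last exact: leqW.
congr addn.
  apply: eq_big_nat => b /andP[_ bl]; rewrite /peak.
  rewrite [eps' b]setn_lt; last by rewrite ltnS (leq_trans (ltnW bl)).
  have [eb|eb] := eqVneq (eps b) 0; first by rewrite eb eq_sym oner_eq0.
  have [/andP[_ nl] _ _ _] := hn b (alive_neq0 eb) bl.
  by rewrite [nxt' b]setn_lt// setn_lt// ltnS (leq_trans nl lj).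
rewrite big_ltn// (eq_big_nat _ _ (F2 := fun=> 0%N)).
  by rewrite big1_eq addn0 /peak /peak_of [nxt' l]setn_at.
move=> i /andP[li ij]; rewrite /peak [eps' i]setn_lt// lz//.
by rewrite eq_sym oner_eq0.
Qed.

End Link.
End LinkKnot.

(** * The scan that builds the primitive and the knots *)

Section Scan.
Context {R : realType} (t v : seq R) (n : nat).
Hypotheses (t01 : unit_partition t) (size_t : size t = n.+1) (size_v : size v = n)
  (n0 : (0 < n)%N).
Implicit Types s : memory R.
Local Notation vv := (nth 0 v).
Local Notation F := (cell_sum t vv).
Local Notation u := (setn vv n (v`_(n - 1) + 1)).

Record scan_inv s : Prop := ScanInv {
  si_n : imem s 0 0 = n;
  si_t : rmem s 0 = nth 0 t;
  si_v : rmem s 1 = u;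
  si_F : forall i, (i <= imem s 4 0)%N -> rmem s 3 i = F i;
  si_scanned : scanned u (imem s 4 0) (imem s 8 0) (rmem s 4) (imem s 2) (imem s 3);
  si_peaks : imem s 7 0 = npeaks (imem s 8 0) (rmem s 4) (imem s 2);
  si_W : forall i, rmem s 5 i = 0
}.

Lemma scan_inv_init : scan_inv (seval (input_memory t v)
  (RSet 1 (reg 0) (RAdd (RGet 1 (ISub (reg 0) (IConst 1))) (RConst 1)))).
Proof.
split=> //=; rewrite ?size_v//.
- by move=> i; rewrite leqn0 => /eqP ->; rewrite /update /= /cell_sum big_ord0.
- split=> //=.
  + by move=> i; lia.
  + by split=> b _; lia.
- by rewrite /npeaks big_geq.
Qed.

Definition scan_step_cost := scost scan_step.

Lemma seval_link_knot s e : (forall k, [\/ rmem s 4 k = 0, rmem s 4 k = 1 | rmem s 4 k = -1]) ->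
  (e = 1) \/ (e = -1) ->
  let j := imem s 4 0 in let l := imem s 8 0 in
  let s0 := rset s 4 (j + 1)%N e in let s' := seval s0 link_knot in
  [/\ forall d, d \notin [:: 2; 3; 7; 8]%N -> imem s' d = imem s d,
      forall d, d != 4%N -> rmem s' d = rmem s d,
      [/\ imem s' 2 = setn (imem s 2) l (j + 1)%N, imem s' 3 = setn (imem s 3) (j + 1)%N l
        & rmem s' 4 = setn (rmem s 4) (j + 1)%N e],
      imem s' 8 0 = (j + 1)%N &
      imem s' 7 0 = (imem s 7 0 + peak_of (setn (rmem s 4) (j + 1)%N e) l (j + 1)%N)%N].
Proof.
move=> sgn he j l s0 s'.
pose s1 := iset (iset s0 2 l (j + 1)%N) 3 (j + 1)%N l.
have [|i2 r2 m2] := @seval_adjust _ s1 (reg 8) next4 incr.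
  move=> k /=; rewrite /update /=; case: eqP => // _.
  by case: he => ->; [constructor 2|constructor 3].
set s2 := seval s1 _ in i2 r2 m2.
have sE : s' = iset s2 8 0 (j + 1)%N.
  rewrite /s' /link_knot seval_seq.
  have -> : seval s0 (ISet 2 (reg 8) next4) = iset s0 2 l (j + 1)%N by [].
  rewrite seval_seq.
  have -> : seval (iset s0 2 l (j + 1)%N) (ISet 3 next4 (reg 8)) = s1 by [].
  rewrite seval_seq -/s2; clearbody s2.
  by rewrite /= i2.
clearbody s2.
rewrite sE; split=> /=.
- move=> d; rewrite !inE !negb_or => /and4P[d2 d3 d7 d8].
  by rewrite row_update// i2// /s1 /= !row_update.
- by move=> d d4; rewrite r2 /= row_update.
- rewrite row_update// row_update// i2// i2// r2; split=> //.
- by [].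
- by rewrite row_update// m2 /= /update /=; case: ifP => _; rewrite ?addn0.
Qed.

Lemma scanned_eps_sign (w eps : nat -> R) j l nxt prv : scanned w j l eps nxt prv ->
  forall k, [\/ eps k = 0, eps k = 1 | eps k = -1].
Proof.
move=> S k; have [kj|jk] := leqP k j; last by constructor 1; exact: (scanned_rest S).
have [->|k0] := posnP k; first by constructor 1; exact: (scanned_first S).
have [|[]|[]|[]] := scanned_sign S (_ : (0 < k <= j)%N); first by rewrite k0.
- by constructor 1.
- by constructor 2.
- by constructor 3.
Qed.

Lemma scan_inv_link s s1 e : scan_inv s -> (imem s 4 0 < n)%N ->
  s1 = rset s 3 (imem s 4 0 + 1)%N (F (imem s 4 0).+1) ->
  (e = 1 /\ u (imem s 4 0) < u (imem s 4 0).+1) \/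
  (e = -1 /\ u (imem s 4 0).+1 < u (imem s 4 0)) ->
  scan_inv (iset (seval (rset s1 4 (imem s 4 0 + 1)%N e) link_knot) 4 0 (imem s 4 0 + 1)%N).
Proof.
move=> [sn st sv sF sS sp sW] jn s1E je.
have sgn := scanned_eps_sign sS.
have i1 : imem s1 = imem s by rewrite s1E.
have r1 a : a != 3%N -> rmem s1 a = rmem s a by move=> a3; rewrite s1E /= row_update.
have := @seval_link_knot s1 e; cbv zeta; rewrite i1 r1// => /(_ sgn)[].
  by case: je => -[-> _]; [left|right].
set s2 := seval _ link_knot; move: s2 => s2 i2 r2 [n2 p2 e2] l2 m2.
have {}r1 : rmem s1 3 = update (rmem s) 3 (imem s 4 0 + 1)%N (F (imem s 4 0).+1) 3.
  by rewrite s1E.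
have ru a : a != 4%N -> update (imem s2) 4 0 (imem s 4 0 + 1)%N a = imem s2 a.
  exact: row_update.
split=> /=.
- by rewrite row_update// i2.
- by rewrite r2// s1E.
- by rewrite r2// s1E.
- move=> i; rewrite r2// r1 /update /= addn1 leq_eqVlt ltnS => /predU1P[->|ij].
    by rewrite eqxx.
  by rewrite ltn_eqF// sF.
- rewrite (ru 8%N)// (ru 2%N)// (ru 3%N)// l2 e2 n2 p2 /update /= addn1.
  exact: scanned_link.
- rewrite (ru 7%N)// (ru 8%N)// (ru 2%N)// l2 e2 n2 m2 sp addn1.
  by rewrite (npeaks_link e sS).
- by move=> i; rewrite r2// s1E; exact: sW.
Qed.

Lemma run_scan_step s : scan_inv s -> (imem s 4 0 < n)%N ->
  runs scan_step s scan_step_cost (fun s' => scan_inv s' /\ imem s' 4 0 = (imem s 4 0).+1).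
Proof.
move=> si jn; have [sn st sv sF sS sp sW] := si.
pose j := imem s 4 0.
apply: runs_loop_free => //; rewrite /scan_step seval_seq.
have s1E : seval s (RSet 3 next4 (RAdd (RGet 3 (reg 4))
    (RMul (RGet 1 (reg 4)) (RSub (RGet 0 next4) (RGet 0 (reg 4)))))) =
    rset s 3 (j + 1)%N (F j.+1).
  rewrite /= -/j st sv sF// cell_sumS addn1 [u j]setn_ne ?ltn_eqF//.
rewrite s1E seval_seq.
set s1 := rset s 3 _ _.
have u1 : rmem s1 1 = u by rewrite /= row_update.
have b1 : beval s1 (BRLe (RGet 1 next4) (RGet 1 (reg 4))) = (u j.+1 <= u j).
  by rewrite /= !row_update// sv addn1.
have b2 : beval s1 (BRLe (RGet 1 (reg 4)) (RGet 1 next4)) = (u j <= u j.+1).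
  by rewrite /= !row_update// sv addn1.
have S3 X : imem X 4 0 = j -> seval X (seti 4 next4) = iset X 4 0 (j + 1)%N.
  by move=> E; rewrite /= E.
have link e : (e = 1 /\ u j < u j.+1) \/ (e = -1 /\ u j.+1 < u j) ->
    imem (seval (rset s1 4 (j + 1)%N e) link_knot) 4 0 = j.
  have [i1 r1] : imem s1 = imem s /\ rmem s1 4 = rmem s 4 by [].
  move=> je; have := @seval_link_knot s1 e; cbv zeta; rewrite r1 i1 -/j.
  move=> /(_ (scanned_eps_sign sS))[]; first by case: je => -[-> _]; [left|right].
  by set s2 := seval _ link_knot => + _ _ _ _; move: s2 => s2 ->.
have seval_if b p q : seval s1 (If b p q) = if beval s1 b then seval s1 p else seval s1 q by [].
rewrite seval_if b1 seval_if b2.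
case: (ltgtP (u j.+1) (u j)) => H.
- have je : (-1 = 1 :> R /\ u j < u j.+1) \/ (-1 = -1 :> R /\ u j.+1 < u j) by right.
  rewrite seval_seq.
  have -> : seval s1 (RSet 4 next4 (RConst (-1))) = rset s1 4 (j + 1)%N (-1) by [].
  rewrite S3; last exact: link.
  split; first exact: scan_inv_link si jn _ je.
  by rewrite /= /update /= addn1.
- have je : (1 = 1 :> R /\ u j < u j.+1) \/ (1 = -1 :> R /\ u j.+1 < u j) by left.
  rewrite seval_seq.
  have -> : seval s1 (RSet 4 next4 (RConst 1)) = rset s1 4 (j + 1)%N 1 by [].
  rewrite S3; last exact: link.
  split; first exact: scan_inv_link si jn _ je.
  by rewrite /= /update /= addn1.
- rewrite /= ; split; last by rewrite /update /= addn1.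
  split=> //=.
  + move=> i; rewrite /update /= addn1 leq_eqVlt ltnS => /predU1P[->|ij].
      by rewrite eqxx.
    by rewrite ltn_eqF// sF.
  + by rewrite /update /= addn1; exact: scanned_skip.
Qed.

Lemma scan_inv_final s : scan_inv s -> imem s 4 0 = n ->
  let s' := seval s (ISet 2 (reg 0) (reg 0) ;; seti 1 (reg 7) ;; seti 4 (IConst 0)) in
  [/\ static t n vv (imem s' 7 0) s',
      flow t n F (rmem s' 4) (imem s' 2) (imem s' 3) 0,
      forall i, rmem s' 5 i = 0,
      imem s' 4 0 = 0%N &
      imem s' 7 0 = npeaks n (rmem s' 4) (imem s' 2)].
Proof.
move=> [sn st sv sF sS sp sW] jn s'.
have s'E : s' = iset (iset (iset s 2 n n) 1 0 (imem s 7 0)) 4 0 0%N.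
  by rewrite /s' /= sn.
rewrite jn in sF sS.
(* The sentinel forces a jump upwards at [n], so [n] carries sign 1 and is the last knot linked. *)
have un : u n.-1 < u n.
  by rewrite setn_at setn_ne; [rewrite subn1 ltrDl ltr01|lia].
have en : rmem s 4 n = 1.
  have [|[_ E]|[]|[_ E]] // := scanned_sign sS (_ : (0 < n <= n)%N); first by rewrite n0 leqnn.
  + by move: un; rewrite E ltxx.
  + by move: un; rewrite ltNge (ltW E).
have [ln al1 lz] := scanned_last sS.
have lE : imem s 8 0 = n.
  apply/eqP; rewrite eqn_leq ln leqNgt; apply/negP => lt.
  by move: en; rewrite lz// => /eqP; rewrite eq_sym oner_eq0.
have E2 : imem s' 2 = setn (imem s 2) n n by rewrite s'E.
have E3 : imem s' 3 = imem s 3 by rewrite s'E.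
have E4 : rmem s' 4 = rmem s 4 by rewrite s'E.
have [hn hp] : linked n (rmem s 4) (imem s 2) (imem s 3) by rewrite -lE; exact: (scanned_linked sS).
have K : knots n (rmem s 4) (setn (imem s 2) n n) (imem s 3).
  split; [split| | |].
  - by move=> b ab bn; rewrite setn_lt//; exact: hn.
  - move=> b ab bn; have [pb ap np] := hp b ab bn.
    by rewrite setn_lt//; have /andP[_] := bn; exact: leq_trans.
  - exact: (scanned_first sS).
  - exact: en.
  - exact: scanned_eps_sign sS.
split.
- by split=> //; rewrite s'E.
- rewrite E2 E3 E4; apply: initial_flow K _ _ _ _ => //.
  + move=> j /andP[j0 jn'].
    have j0n : (0 < j <= n)%N by rewrite j0 ltnW.
    have uj : u j = vv j by rewrite setn_lt.
    have uj1 : u j.-1 = vv j.-1 by rewrite setn_lt//; lia.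
    have := scanned_sign sS j0n; rewrite uj uj1.
    have z1 : (0 == 1 :> R) = false by rewrite eq_sym oner_eq0.
    have z2 : (0 == -1 :> R) = false by rewrite eq_sym oppr_eq0 oner_eq0.
    have z3 : (-1 == 1 :> R) = false by rewrite eq_sym one_eqN1.
    by case=> -[-> H]; split=> // /eqP;
      rewrite ?z1 ?z2 ?z3 ?one_eqN1 ?oppr_eq0 ?oner_eq0.
  + exact: (scanned_prv sS).
  + by rewrite setn_at.
  + move=> b bn db; have [n1 p1] := scanned_dead sS db.
    rewrite p1 setn_ne//; apply: contraNneq db => ->.
    by apply: alive_neq0; rewrite en oner_eq0.
- by move=> i; rewrite s'E; exact: sW.
- by rewrite s'E.
- rewrite E2 E4 s'E /= /update /= sp lE; apply: eq_big_nat => b /andP[_ bn].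
  by rewrite /peak setn_lt.
Qed.

Definition scan_cost :=
  (scost (RSet 1 (reg 0) (RAdd (RGet 1 (ISub (reg 0) (IConst 1))) (RConst 1))) +
  (n * (scan_step_cost + 8) + 8 +
  scost (ISet 2 (reg 0) (reg 0) ;; seti 1 (reg 7) ;; seti 4 (IConst 0))))%N.

Lemma run_scan : runs scan (input_memory t v) scan_cost (fun s' =>
  [/\ static t n vv (imem s' 7 0) s',
      flow t n F (rmem s' 4) (imem s' 2) (imem s' 3) 0,
      forall i, rmem s' 5 i = 0,
      imem s' 4 0 = 0%N &
      imem s' 7 0 = npeaks n (rmem s' 4) (imem s' 2)]).
Proof.
apply: (@runs_seq _ _ _ _ _ _ (fun s => scan_inv s /\ imem s 4 0 = 0%N)).
  by apply: runs_loop_free => //; split; [exact: scan_inv_init|].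
move=> s [si s0].
apply: (@runs_seq _ _ _ _ _ _ (fun s => scan_inv s /\ imem s 4 0 = n)).
  pose I k s1 := scan_inv s1 /\ (imem s1 4 0 + k = n)%N.
  apply: (runs_le (leqnn _) _ (@runs_while _ _ _ scan_step_cost I n s _ _)).
  - move=> s' [[k [si' jk]] /= g]; split=> //; move: g; rewrite (si_n si'); lia.
  - by split; rewrite ?s0.
  - move=> k s1 [si1 jk] /=; rewrite (si_n si1) addn1 => g.
    exists k.-1; first lia.
    apply: runs_le (run_scan_step si1 g) => // s2 [si2 j2].
    by split=> //; rewrite j2; lia.
move=> s1 [si1 j1]; apply: runs_loop_free => //; exact: scan_inv_final.
Qed.


End Scan.

(** * Running time and correctness *)

Section Cost.

Definition total_cost n :=
  (scan_cost n + (n.+1 * (init_step_cost n + 6) + 6 + (n * (step_cost n + 5) + 5)))%N.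

Lemma update_cost_le n : (update_cost n <= (scost set_leaf + scost pull_up + 10) * (depth n).+1)%N.
Proof. by rewrite /update_cost; nia. Qed.

Lemma total_cost_le : exists C, forall n, (total_cost n <= C * (n.+1 * (depth n).+1))%N.
Proof.
pose c1 := (scost set_leaf + scost pull_up + 10)%N.
pose c2 := (scost delete_knot + 3 * c1 + 60)%N.
pose c3 := (scan_step_cost + 100)%N.
exists (c1 + c2 + c3 + 100)%N => n; rewrite /total_cost.
have d0 : (0 < (depth n).+1)%N by [].
have H1 : (init_step_cost n + 6 <= (c1 + 16) * (depth n).+1)%N.
  by rewrite /init_step_cost; have := update_cost_le n; rewrite -/c1; nia.
have H2 : (step_cost n + 5 <= c2 * (depth n).+1)%N.
  rewrite /step_cost /refresh_cost /c2; have := update_cost_le n; rewrite -/c1; nia.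
have H3 : (scan_cost n + 11 <= c3 * n.+1)%N.
  by rewrite /scan_cost /c3 /=; nia.
move: H1 H2 H3; move: c1 c2 c3 (init_step_cost n) (step_cost n) (scan_cost n) (depth n).+1 d0.
move=> c1 c2 c3 x y z d d0 H1 H2 H3.
have A := leq_mul (leqnn n.+1) H1; have B := leq_mul (leqnn n) H2.
have D : (c3 * n.+1 * 1 <= c3 * n.+1 * d)%N by rewrite leq_mul2l d0 orbT.
have E : (n * (c2 * d) <= n.+1 * (c2 * d))%N by rewrite leq_mul2r leqnSn orbT.
nia.
Qed.

Context (R : realType).

Lemma depth_ln n : (1 < n)%N -> ((depth n).+1%:R : R) <= 3 / ln 2 * ln n%:R.
Proof.
move=> n1; have n0 : (0 < n)%N by lia.
have ln2 : 0 < ln 2 :> R by rewrite ln_gt0// ltr1n.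
have k1 : (1 <= trunc_log 2 n)%N by rewrite trunc_log_gt0.
have H : (trunc_log 2 n)%:R * ln 2 <= ln n%:R :> R.
  rewrite mulr_natl -lnXn ?ltr0n// ler_ln ?posrE ?exprn_gt0 ?ltr0n//.
  by rewrite -natrX ler_nat trunc_logP.
(* The left side is [trunc_log 2 n + 2], and for [n >= 2] the logarithm is at least 1; this is the
   origin of the factor 3. *)
apply: (@le_trans _ _ (3 * (trunc_log 2 n)%:R)).
  by rewrite -natrM ler_nat /depth; lia.
by rewrite -mulrA ler_pM2l// ler_pdivlMl// mulrC.
Qed.

Lemma total_cost_bigO :
  (fun n : nat => (total_cost n)%:R : R^o) =O_\oo
      (fun n : nat => n%:R * ln (n%:R : R) : R^o).
Proof.
have [C HC] := total_cost_le.
apply/eqOP; near=> k; near=> n.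
have n1 : (1 < n)%N by near: n; exact: nbhs_infty_gt.
have n0 : (0 < n%:R :> R) by rewrite ltr0n; lia.
have l0 : 0 < ln n%:R :> R by rewrite ln_gt0// ltr1n.
have ln2 : 0 < ln 2 :> R by rewrite ln_gt0// ltr1n.
rewrite /= [leLHS]ger0_norm ?ler0n// [X in _ <= _ * X]ger0_norm; last by rewrite mulr_ge0// ltW.
apply: (@le_trans _ _ (C%:R * (2 * n%:R * (3 / ln 2 * ln n%:R)))).
  apply: (@le_trans _ _ (C * (n.+1 * (depth n).+1))%:R); first by rewrite ler_nat.
  rewrite natrM ler_wpM2l// natrM ler_pM//; last exact: depth_ln.
  by rewrite -natrM ler_nat; lia.
rewrite (_ : C%:R * _ = (C%:R * 2 * (3 / ln 2)) * (n%:R * ln n%:R)); last by ring.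
rewrite ler_pM2r ?mulr_gt0//; near: k.
Unshelve. all: by end_near.
Qed.

End Cost.

Section Correct.
Context (R : realType) (t v : seq R) (f : R -> R).
Hypotheses (t01 : unit_partition t) (size_t : size t = (size v).+1)
  (fX : stepX t f) (fv : forall i, (i < size v)%N -> forall x, x \in `]t`_i, t`_i.+1[ -> f x = v`_i).

Lemma size_gt0 : (0 < size v)%N.
Proof.
case/and3P: t01 => _ /eqP h /eqP l; move: size_t h l.
case: v => //=; case: t => // a [|//] _ /= -> /eqP; by rewrite eq_sym oner_eq0.
Qed.

Lemma run_signatures : runs signatures_program (input_memory t v) (total_cost (size v))
  (fun s => (forall k, (k < size (output_of s))%N ->
              (output_of s)`_k = signature t f k /\ 0 < signature t f k) /\
     forall k, (size (output_of s) <= k)%N -> signature t f k = 0).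
Proof.
have n0 := size_gt0; have fv' : step_values t (size v) f (nth 0 v) by [].
apply: runs_seq (run_scan t01 size_t erefl n0) _.
move=> s1 [ss W W0 s4 s7].
(* At radius 0 the string is the primitive of [f] itself, so the upper bound of the initial flow is
   0 for every [k] from the initial number of peaks on. *)
have zero k : (imem s1 7 0 <= k)%N -> signature t f k = 0.
  move=> mk; apply/eqP; rewrite eq_le (signature_ge0 t01 size_t n0 fv') andbT.
  apply: (signature_le_taut t01 size_t n0 fv' (flow_knots W) (flow_taut W) (flow_tube W)) => //.
  by rewrite -s7.
apply: runs_seq (run_init_rates t01 size_t n0 f ss W W0 s4 s7 erefl) _.
move=> s2 i2.
apply: runs_le (run_main_loop t01 size_t n0 fv' i2) => // s3 [[s3s _ _ _ _ out] m0].
rewrite /output_of size_mkseq (static_M s3s); split=> // k km.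
by rewrite nth_mkseq//; apply: out; rewrite m0 km.
Qed.

End Correct.

Theorem mainTheorem9 (R : realType) :
  exists (p : cmd) (T : nat -> nat),
    (fun n : nat => (T n)%:R : R^o) =O_\oo
      (fun n : nat => n%:R * ln (n%:R : R) : R^o) /\
    forall (t v : seq R) (f : R -> R),
      unit_partition t ->
      size t = (size v).+1 ->
      stepX t f ->
      (forall i, (i < size v)%N ->
         forall x, x \in `]t`_i, t`_i.+1[ -> f x = v`_i) ->
      exists (c : nat) (s : memory R),
        [/\ exec p (input_memory t v) c s,
            (c <= T (size v))%N,
            forall k, (k < size (output_of s))%N ->
              (output_of s)`_k = signature t f k /\ 0 < signature t f k
          & forall k, (size (output_of s) <= k)%N -> signature t f k = 0].
Proof.
exists signatures_program, total_cost; split; first exact: total_cost_bigO.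
move=> t v f t01 size_t _ fv.
by have [c [s [e cT [h1 h2]]]] := run_signatures t01 size_t fv; exists c, s.
Qed.
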